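(* There is a constant $c>0$ and an integer $M_0$ such that for all integers $n\geq 2$, all integers $M\geq M_0$ and all polytopes $P_M\subset\mathbb{R}^n$ with no more than $M$ facets, $$\Delta_s(B_2^n,P_M)\geq c\,\frac{\mathrm{vol}_{n-1}(\partial B_2^n)}{M^{\frac{2}{n-1}}}.$$
   Context: $B_2^n$ denotes the closed Euclidean unit ball in $\mathbb{R}^n$; $\mathrm{vol}_{n-1}$ denotes $(n-1)$-dimensional surface measure. For convex bodies $K,L\subset\mathbb{R}^n$ the symmetric surface area deviation is $$\Delta_s(K,L)=\mathrm{vol}_{n-1}\big(\partial(K\cup L)\big)-\mathrm{vol}_{n-1}\big(\partial(K\cap L)\big).$$ No containment relation between $P_M$ and $B_2^n$ is assumed. *)

(* Defs.v *)
From HB Require Import structures.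
From mathcomp Require Import all_boot all_order all_algebra.
From mathcomp Require Import all_classical all_reals all_analysis.
Set Implicit Arguments. Unset Strict Implicit. Unset Printing Implicit Defensive.
Import Order.TTheory GRing.Theory Num.Theory.
Import numFieldNormedType.Exports.
Local Open Scope classical_set_scope.
Local Open Scope ring_scope.

Section Defs.
Variable R : realType.

Definition dotv (n : nat) (x y : 'rV[R]_n) : R := \sum_(i < n) x ord0 i * y ord0 i.
Definition enorm (n : nat) (x : 'rV[R]_n) : R := Num.sqrt (dotv x x).

Definition eball (n : nat) : set 'rV[R]_n := [set x | enorm x <= 1].

Definition bd (n : nat) (A : set 'rV[R]_n) : set 'rV[R]_n :=
  closure A `\` interior A.

(* Euclidean diameter (diameter of the empty set is 0) *)
Definition ediam (n : nat) (C : set 'rV[R]_n) : \bar R :=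
  ereal_sup ([set r | exists x y, C x /\ C y /\ r = (enorm (x - y))%:E]
             `|` [set 0%E]).

Definition hausdorff_delta (n s : nat) (delta : R) (A : set 'rV[R]_n) : \bar R :=
  ereal_inf [set S | exists C : nat -> set 'rV[R]_n,
    A `<=` \bigcup_k C k /\ (forall k, (ediam (C k) <= delta%:E)%E) /\
    S = (\sum_(0 <= k <oo) ((fine (ediam (C k))) ^+ s)%:E)%E].

(* unnormalized s-dimensional Hausdorff measure (normalizing constant
   depends only on s and cancels in the theorem) *)
Definition hausdorff (n s : nat) (A : set 'rV[R]_n) : \bar R :=
  ereal_sup [set h | exists delta : R, 0 < delta /\ h = hausdorff_delta s delta A].

Definition vol_surf (n : nat) (A : set 'rV[R]_n) : \bar R := hausdorff n.-1 A.

Definition Delta_s (n : nat) (K L : set 'rV[R]_n) : \bar R :=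
  (vol_surf (bd (K `|` L)) - vol_surf (bd (K `&` L)))%E.

Definition polytope_le_facets (n M : nat) (P : set 'rV[R]_n) : Prop :=
  exists (m : nat) (a : 'I_m -> 'rV[R]_n) (b : 'I_m -> R),
    (m <= M)%N /\
    P = [set x | forall i, dotv (a i) x <= b i] /\
    (exists r : R, forall x, P x -> enorm x <= r) /\
    (exists x, interior P x).

End Defs.

(* Main.v *)
(** Let S be the unit sphere, s = n - 1, and H the s-dimensional Hausdorff
    measure.  Put A1 = S \ P, A2 = S /\ int P, let F1 be the part of the facets
    outside the ball and F2 the part inside.  Up to null sets the deviation is
    H(A1) + H(F1) - H(A2) - H(F2).

    F2 is the image of a part of A1 under the nearest-point projection onto P,
    and A2 is contained in the radial projection of F1.  Both maps are
    1-Lipschitz, and at a point whose direction makes an angle with sine at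
    least s0 with the normal of the facet at hand, they contract one tangent
    direction by the factor sqrt (1 - s0^2), hence H by the same factor.  The
    directions closer than that to one of the at most M facet normals form M
    caps; for s0 = M^(-1/s) / 4 these cover at most half of S.  So the deviation
    is at least (1 - sqrt (1 - s0^2)) H(S) / 2 >= M^(-2/s) H(S) / 64.

    That a map that contracts one direction by a factor l contracts H by l is
    first proved for linear maps of a hyperplane: on strips orthogonal to the
    direction it is Cauchy's functional equation for the translation-invariant
    H, and strips generate the Borel sets.  The smooth case follows by
    linearizing on a countable cover by small balls. *)

Require Import Defs.
From HB Require Import structures.
From mathcomp Require Import all_boot all_order all_algebra.
From mathcomp Require Import all_classical all_reals all_analysis.
From mathcomp Require Import ring lra.
Import Order.TTheory GRing.Theory Num.Theory.
Import numFieldNormedType.Exports.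
Local Open Scope classical_set_scope.
Local Open Scope ring_scope.
Set Implicit Arguments. Unset Strict Implicit. Unset Printing Implicit Defensive.

(** Without any containment between the ball and P, each boundary has parts that gain and parts that
    lose, and no part of the deviation has a sign by itself. The two projections pair the parts so
    that each pair does: with l = sqrt (1 - s0^2), they give H(A1) - H(F2) >= (1 - l) H(A1 far) and
    H(F1) - H(A2) >= (1 - l) H(A2 far), where far means away from all facet normals. The two far
    parts together fill the far part of S up to a null set, so the sum of the two bounds does not
    depend on how P cuts the sphere. The gain 1 - l vanishes at directions parallel to a normal, and
    this is where the number of facets enters: s0 should be as large as possible while the caps
    still leave half of S. As the measure of a cap is of order s0^s, this forces s0 of order
    M^(-1/s), and since 1 - l is of order s0^2, the exponent 2/s appears. *)

Section ContinuousFun.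
Variables (R : realType) (T : topologicalType) (W : normedModType R).
Implicit Types (f g : T -> W) (c d : T -> R).

Lemma continuous_funD f g :
  continuous f -> continuous g -> continuous (fun t => f t + g t).
Proof. by move=> cf cg t; apply: cvgD; [exact: cf|exact: cg]. Qed.

Lemma continuous_funB f g :
  continuous f -> continuous g -> continuous (fun t => f t - g t).
Proof. by move=> cf cg t; apply: cvgB; [exact: cf|exact: cg]. Qed.

Lemma continuous_funZ c f :
  continuous c -> continuous f -> continuous (fun t => c t *: f t).
Proof. by move=> cc cf t; apply: cvgZ; [exact: cc|exact: cf]. Qed.

Lemma continuous_funM c d :
  continuous c -> continuous d -> continuous (fun t => c t * d t).
Proof. by move=> cc cd t; apply: cvgM; [exact: cc|exact: cd]. Qed.

Lemma continuous_fun_sqrt c : continuous c -> continuous (fun t => Num.sqrt (c t)).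
Proof.
move=> cc t; apply: (@continuous_comp _ _ _ c); first exact: cc.
exact: sqrt_continuous.
Qed.

Lemma continuous_fun_cst (a : W) : continuous (fun _ : T => a).
Proof. by move=> t; exact: cvg_cst. Qed.

End ContinuousFun.

Lemma continuous_fun_id (T : topologicalType) : continuous (fun t : T => t).
Proof. by move=> t. Qed.

#[global] Hint Extern 0 (continuous_at _ _) =>
  solve [exact: continuous_fun_id | exact: continuous_fun_cst] : core.

(** * The Euclidean norm *)

Section Euclid.
Variables (R : realType) (n : nat).
Implicit Types (x y z u : 'rV[R]_n) (a : R).

Lemma dotvC x y : dotv x y = dotv y x.
Proof. by apply: eq_bigr => i _; rewrite mulrC. Qed.

Lemma dotvDl x y z : dotv (x + y) z = dotv x z + dotv y z.
Proof. by rewrite -big_split; apply: eq_bigr => i _; rewrite mxE mulrDl. Qed.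

Lemma dotvDr x y z : dotv z (x + y) = dotv z x + dotv z y.
Proof. by rewrite dotvC dotvDl !(dotvC z). Qed.

Lemma dotvZl a x y : dotv (a *: x) y = a * dotv x y.
Proof. by rewrite mulr_sumr; apply: eq_bigr => i _; rewrite mxE mulrA. Qed.

Lemma dotvZr a x y : dotv x (a *: y) = a * dotv x y.
Proof. by rewrite dotvC dotvZl dotvC. Qed.

Lemma dotvNl x y : dotv (- x) y = - dotv x y.
Proof. by rewrite -scaleN1r dotvZl mulN1r. Qed.

Lemma dotvNr x y : dotv x (- y) = - dotv x y.
Proof. by rewrite dotvC dotvNl dotvC. Qed.

Lemma dotv0l x : dotv 0 x = 0.
Proof. by rewrite -(scale0r 0) dotvZl mul0r. Qed.

Definition dotvE := (dotvDl, dotvDr, dotvNl, dotvNr, dotvZl, dotvZr).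

Lemma dotv_ge0 x : 0 <= dotv x x.
Proof. by apply: sumr_ge0 => i _; rewrite -expr2 sqr_ge0. Qed.

Lemma dotv_eq0 x : (dotv x x == 0) = (x == 0).
Proof.
apply/idP/eqP => [|->]; last by rewrite dotv0l.
rewrite psumr_eq0 => [/allP x0|i _]; last by rewrite -expr2 sqr_ge0.
apply/rowP => i; rewrite mxE; apply/eqP.
by have := x0 i (mem_index_enum i); rewrite mulf_eq0 orbb.
Qed.

Lemma enorm_ge0 x : 0 <= enorm x.
Proof. exact: sqrtr_ge0. Qed.

Lemma sqr_enorm x : enorm x ^+ 2 = dotv x x.
Proof. by rewrite sqr_sqrtr// dotv_ge0. Qed.

Lemma enorm_eq0 x : (enorm x == 0) = (x == 0).
Proof. by rewrite -sqrf_eq0 sqr_enorm dotv_eq0. Qed.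

Lemma enorm0 : enorm (0 : 'rV[R]_n) = 0.
Proof. by apply/eqP; rewrite enorm_eq0. Qed.

Lemma enormZ a x : enorm (a *: x) = `|a| * enorm x.
Proof.
by rewrite /enorm dotvZl dotvZr mulrA -expr2 sqrtrM ?sqr_ge0// sqrtr_sqr.
Qed.

Lemma enormN x : enorm (- x) = enorm x.
Proof. by rewrite -scaleN1r enormZ normrN1 mul1r. Qed.

Lemma enormBC x y : enorm (x - y) = enorm (y - x).
Proof. by rewrite -enormN opprB. Qed.

Lemma cauchy_schwarz_sqr x y : dotv x y ^+ 2 <= dotv x x * dotv y y.
Proof.
have [/eqP|y0] := boolP (dotv y y == 0).
  move/eqP; rewrite dotv_eq0 => /eqP ->.
  by rewrite dotvC !dotv0l expr0n mulr0.
have yy : 0 < dotv y y by rewrite lt_def y0 dotv_ge0.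
have := dotv_ge0 (dotv y y *: x - dotv x y *: y).
rewrite !dotvE (dotvC y x) => H.
have : 0 <= dotv y y * (dotv x x * dotv y y - dotv x y ^+ 2) by move: H; nra.
by rewrite pmulr_rge0// subr_ge0.
Qed.

Lemma cauchy_schwarz x y : `|dotv x y| <= enorm x * enorm y.
Proof.
rewrite -ler_sqr ?nnegrE ?mulr_ge0 ?enorm_ge0// exprMn !sqr_enorm.
by rewrite real_normK ?num_real// cauchy_schwarz_sqr.
Qed.

Lemma enormD x y : enorm (x + y) <= enorm x + enorm y.
Proof.
rewrite -ler_sqr ?nnegrE ?addr_ge0 ?enorm_ge0// sqrrD !sqr_enorm !dotvE.
rewrite (dotvC y x); have := le_trans (ler_norm _) (cauchy_schwarz x y); lra.
Qed.

Lemma enorm_dist x y z : enorm (x - z) <= enorm (x - y) + enorm (y - z).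
Proof. by rewrite (le_trans _ (enormD _ _))// addrA subrK. Qed.

Lemma enormB_ge x y : `|enorm x - enorm y| <= enorm (x - y).
Proof.
rewrite ler_norml; apply/andP; split.
  by have := enormD x (y - x); rewrite addrC subrK enormBC; lra.
by have := enormD y (x - y); rewrite addrC subrK; lra.
Qed.

Lemma continuous_dotv (T : topologicalType) (f g : T -> 'rV[R]_n) :
  continuous f -> continuous g -> continuous (fun t => dotv (f t) (g t)).
Proof.
move=> cf cg; apply: (continuous_big (op := +%R) (x0 := 0)) => /=.
- by move=> x; exact: add_continuous.
- move=> i _ x; apply: cvgM.
  + exact: (continuous_comp (cf x) (@coord_continuous _ _ _ _ _ (f x))).
  + exact: (continuous_comp (cg x) (@coord_continuous _ _ _ _ _ (g x))).
Qed.

Lemma continuous_dotvl u : continuous (fun x => dotv x u).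
Proof. by apply: (@continuous_dotv 'rV[R]_n (fun x => x) (fun=> u)). Qed.

Lemma continuous_dotvr u : continuous (fun x => dotv u x).
Proof. by apply: (@continuous_dotv 'rV[R]_n (fun=> u) (fun x => x)). Qed.

Lemma continuous_enorm (T : topologicalType) (f : T -> 'rV[R]_n) :
  continuous f -> continuous (fun t => enorm (f t)).
Proof.
by move=> cf; apply: continuous_fun_sqrt; exact: continuous_dotv.
Qed.

Lemma continuous_enorm_id : continuous (fun x => enorm x).
Proof. exact: (@continuous_enorm 'rV[R]_n (fun x => x)). Qed.

Lemma closed_eball : closed (@eball R n).
Proof.
rewrite (_ : @eball R n = (fun x => enorm x) @^-1` [set t | t <= 1])//.
by apply: closed_comp; [move=> y _; exact: continuous_enorm_id|exact: closed_le].
Qed.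

Lemma coord_le_enorm x i : `|x ord0 i| <= enorm x.
Proof.
rewrite -ler_sqr ?nnegrE ?enorm_ge0// real_normK ?num_real// sqr_enorm.
rewrite /dotv (bigD1 i)//= -expr2 lerDl; apply: sumr_ge0 => j _.
by rewrite -expr2 sqr_ge0.
Qed.

Lemma open_enorm_ball p (r : R) : open [set x : 'rV[R]_n | enorm (x - p) < r].
Proof.
rewrite (_ : mkset _ = (fun x : 'rV[R]_n => enorm (x - p)) @^-1` [set t | t < r])//.
apply: open_comp; last exact: open_lt.
move=> x _; apply: continuous_enorm; apply: continuous_funB => //.

Qed.

Lemma open_enorm_nbhs (U : set 'rV[R]_n) p : open U -> U p ->
  exists2 r : R, 0 < r & forall x, enorm (x - p) < r -> U x.
Proof.
rewrite openE => /(_ _)/[apply] /nbhs_ballP[r /= r0 rU].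
exists r => // x xp; apply: rU; split=> // i j; rewrite ord1 /ball/=.
rewrite (le_lt_trans _ xp)// -(enormN (x - p)) opprB.
by have := coord_le_enorm (p - x) j; rewrite !mxE.
Qed.

End Euclid.

#[global] Hint Extern 0 (continuous_at _ _) =>
  solve [exact: continuous_dotvl | exact: continuous_dotvr] : core.

(** * Hausdorff measure *)

Section Hausdorff.
Variables (R : realType) (n : nat).
Implicit Types (A B C : set 'rV[R]_n) (delta : R).
Local Open Scope ereal_scope.

Lemma ediam_ge0 A : 0 <= ediam A.
Proof. by apply: ereal_sup_ubound; right. Qed.

Lemma ediam_le A (d : R) : (0 <= d)%R ->
  (forall x y, A x -> A y -> enorm (x - y) <= d)%R -> ediam A <= d%:E.
Proof.
move=> d0 Ad; apply: ge_ereal_sup => _ [[x [y [Ax [Ay ->]]]]|->].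
  by rewrite lee_fin Ad.
by rewrite lee_fin.
Qed.

Lemma enorm_le_ediam A x y : A x -> A y -> (enorm (x - y))%:E <= ediam A.
Proof. by move=> Ax Ay; apply: ereal_sup_ubound; left; exists x, y. Qed.

Lemma ediam_set0 : ediam (@set0 'rV[R]_n) = 0.
Proof. by apply/eqP; rewrite eq_le ediam_ge0 andbT; apply: ediam_le. Qed.

Lemma ediam_fin A delta : ediam A <= delta%:E ->
  [/\ ediam A = (fine (ediam A))%:E, (0 <= fine (ediam A))%R &
      (fine (ediam A) <= delta)%R].
Proof.
move=> Ad; have fA : ediam A \is a fin_num.
  by rewrite ge0_fin_numE ?ediam_ge0// (le_lt_trans Ad)// ltry.
by split; rewrite ?fineK ?fine_ge0 ?ediam_ge0// -lee_fin fineK.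
Qed.

(* The exponent is [s.+1] because a cover by empty sets would cost [0 ^+ 0 = 1]
   per set in dimension 0. *)
Definition hd (s : nat) delta A := hausdorff_delta s.+1 delta A.
Definition hm (s : nat) A := hausdorff s.+1 A.

Lemma hd_le s delta A (C : nat -> set 'rV[R]_n) : A `<=` \bigcup_k C k ->
  (forall k, ediam (C k) <= delta%:E) ->
  hd s delta A <= \sum_(0 <= k <oo) ((fine (ediam (C k))) ^+ s.+1)%:E.
Proof. by move=> AC Cd; apply: ereal_inf_lbound; exists C. Qed.

Lemma hd_ge s delta A (x : \bar R) :
  (forall C : nat -> set 'rV[R]_n, A `<=` \bigcup_k C k ->
  (forall k, ediam (C k) <= delta%:E) ->
  x <= \sum_(0 <= k <oo) ((fine (ediam (C k))) ^+ s.+1)%:E) -> x <= hd s delta A.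
Proof. by move=> H; apply: le_ereal_inf_tmp => _ [C [AC [Cd ->]]]; exact: H. Qed.

Lemma hd_ge0 s delta A : 0 <= hd s delta A.
Proof.
apply: hd_ge => C _ _; apply: nneseries_ge0 => k _ _.
by rewrite lee_fin exprn_ge0// fine_ge0// ediam_ge0.
Qed.

Lemma hd_mono s delta A B : A `<=` B -> hd s delta A <= hd s delta B.
Proof. by move=> AB; apply: hd_ge => C BC; apply: hd_le; apply: subset_trans BC. Qed.

Lemma hd_anti s d1 d2 A : (d1 <= d2)%R -> hd s d2 A <= hd s d1 A.
Proof.
move=> d12; apply: hd_ge => C AC Cd; apply: hd_le => // k.
by rewrite (le_trans (Cd k))// lee_fin.
Qed.

Lemma hd_diam s delta A : ediam A <= delta%:E ->
  hd s delta A <= (fine (ediam A) ^+ s.+1)%:E.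
Proof.
move=> Ad; have d0 : 0 <= delta%:E by rewrite (le_trans _ Ad)// ediam_ge0.
apply: le_trans (hd_le s (C := fun k => if k is 0 then A else set0) _ _) _.
- by move=> x Ax; exists 0%N.
- by case=> //= _; rewrite ediam_set0.
- rewrite (nneseries_split 0 1)//=; last first.
    by move=> k _; rewrite lee_fin exprn_ge0// fine_ge0// ediam_ge0.
  rewrite big_nat1 eseries0 ?adde0// => -[|k]// _ _.
  by rewrite ediam_set0 expr0n.
Qed.

Lemma hd_set0 s delta : (0 <= delta)%R -> hd s delta set0 = 0.
Proof.
move=> d0; apply/eqP; rewrite eq_le hd_ge0 andbT.
by rewrite (le_trans (hd_diam _ _))// ?ediam_set0//= expr0n.
Qed.

Lemma nneseries_nat2 (f : nat -> (nat * nat)%type) (G : nat -> nat -> \bar R) :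
  bijective f -> (forall i j, 0 <= G i j) ->
  \sum_(0 <= k <oo) G (f k).1 (f k).2 =
  \sum_(0 <= i <oo) \sum_(0 <= j <oo) G i j.
Proof.
move=> bf G0.
rewrite (eq_eseriesr (f := fun i => \sum_(0 <= j <oo) G i j)
  (g := fun i => \esum_(j in [set: nat]) G i j)); last first.
  by move=> i _; rewrite nneseries_esumT.
rewrite !nneseries_esumT//; last by move=> i; exact: esum_ge0.
rewrite esum_esum//.
rewrite (_ : _ `*`` _ = setT); last by apply/seteqP; split.
by rewrite (reindex_esum setT _ f)// setTT_bijective.
Qed.

Lemma hd_sigma_subadditive s delta : sigma_subadditive (hd s delta).
Proof.
move=> F; have [[i ioo]|] := pselect (exists i, hd s delta (F i) = +oo).
  rewrite (eseries_pinfty _ _ ioo) ?leey// => k _.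
  by rewrite -ltNye (lt_le_trans _ (hd_ge0 _ _ _)).
rewrite -forallNE => Foo; apply/lee_addgt0Pr => _/posnumP[e].
rewrite (le_trans _ (epsilon_trick _ _ _))//; last first.
  by move=> k; exact: hd_ge0.
pose P k (C : nat -> set 'rV[R]_n) := [/\ F k `<=` \bigcup_j C j,
  (forall j, ediam (C j) <= delta%:E) &
  \sum_(0 <= j <oo) ((fine (ediam (C j))) ^+ s.+1)%:E <=
    hd s delta (F k) + (e%:num / (2 ^ k.+1)%:R)%:E].
have [C PC] : {C : nat -> nat -> set 'rV[R]_n & forall k, P k (C k)}.
  apply: (@choice _ _ P) => k; rewrite /P /hd.
  have : hd s delta (F k) \is a fin_num.
    by rewrite ge0_fin_numE ?hd_ge0// ltey; apply/eqP.
  have e0 : (0 < e%:num / (2 ^ k.+1)%:R)%R by [].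
  move=> /(lb_ereal_inf_adherent e0)[_ [C [FC [Cd ->]]] /ltW Ce].
  by exists C.
have /card_esym/ppcard_eqP[f] := card_nat2.
have bf : bijective f by rewrite -setTT_bijective.
pose G i j := ((fine (ediam (C i j))) ^+ s.+1)%:E.
apply: (@le_trans _ _ (\sum_(0 <= i <oo) \sum_(0 <= j <oo) G i j)); last first.
  have G0 i j : 0 <= G i j by rewrite lee_fin exprn_ge0// fine_ge0// ediam_ge0.
  apply: lee_nneseries => i _; first by move=> _; exact: nneseries_ge0.
  by have [_ _] := PC i.
rewrite -(nneseries_nat2 bf) => [|i j]; last first.
  by rewrite lee_fin exprn_ge0// fine_ge0// ediam_ge0.
apply: (hd_le s (C := fun k => C (f k).1 (f k).2)) => [x [i _]|k].
  have [+ _ _] := PC i; move=> /[apply] -[j _ Cx].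
  by case: bf => g _ gK; exists (g (i, j)) => //; rewrite gK.
by have [_ + _] := PC (f k).1; exact.
Qed.

Lemma hm_ge0 s A : 0 <= hm s A.
Proof. by apply: le_trans (hd_ge0 s 1 A) (ereal_sup_ubound _); exists 1%R. Qed.

Lemma hd_le_hm s delta A : (0 < delta)%R -> hd s delta A <= hm s A.
Proof. by move=> d0; apply: ereal_sup_ubound; exists delta. Qed.

Lemma hm_le s A (x : \bar R) :
  (forall delta, (0 < delta)%R -> hd s delta A <= x) -> hm s A <= x.
Proof. by move=> H; apply: ge_ereal_sup => _ [d [d0 ->]]; exact: H. Qed.

Lemma hm_set0 s : hm s (@set0 'rV[R]_n) = 0.
Proof.
apply/eqP; rewrite eq_le hm_ge0 andbT.
by apply: hm_le => d d0; rewrite hd_set0// ltW.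
Qed.

Lemma hm_mono s : {homo hm s : A B / A `<=` B >-> A <= B}.
Proof.
move=> A B AB; apply: hm_le => d d0.
exact: le_trans (hd_mono _ _ AB) (hd_le_hm _ _ d0).
Qed.

Lemma hm_sigma_subadditive s : sigma_subadditive (hm s : set 'rV[R]_n -> _).
Proof.
move=> F; apply: hm_le => d d0; apply: le_trans (hd_sigma_subadditive _ _ _) _.
by apply: lee_nneseries => i _; [move=> _; exact: hd_ge0|exact: hd_le_hm].
Qed.

HB.instance Definition _ s := isOuterMeasure.Build R 'rV[R]_n (hm s)
  (hm_set0 s) (hm_ge0 s) (@hm_mono s) (@hm_sigma_subadditive s).

Lemma nneseries_le (f : nat -> \bar R) (x : \bar R) : (forall k, 0 <= f k) ->
  (forall N, \sum_(k < N) f k <= x) -> \sum_(0 <= k <oo) f k <= x.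
Proof.
move=> f0 fx; apply: lime_le; first by apply: is_cvg_nneseries => k _ _.
by apply: nearW => N; rewrite big_mkord.
Qed.

(* Comparing two maps makes Lipschitz bounds and expansion bounds instances of
   one statement, with no inverse map involved. *)
Lemma hm_lipschitz s (L : R) A (f g : 'rV[R]_n -> 'rV[R]_n) : (0 < L)%R ->
  (forall x y, A x -> A y -> enorm (f x - f y) <= L * enorm (g x - g y))%R ->
  hm s (f @` A) <= (L ^+ s.+1)%:E * hm s (g @` A).
Proof.
move=> L0 fg; apply: hm_le => d d0.
apply: (@le_trans _ _ ((L ^+ s.+1)%:E * hd s (d / L) (g @` A))); last first.
  by rewrite lee_pmul2l// ?lte_fin ?exprn_gt0// hd_le_hm// divr_gt0.
rewrite muleC -lee_pdivrMr ?exprn_gt0// muleC.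
apply: hd_ge => C gC Cd; rewrite muleC lee_pdivrMr ?exprn_gt0// muleC.
pose D k := f @` (A `&` g @^-1` C k).
have DC k : ediam (D k) <= (L * fine (ediam (C k)))%:E.
  have [Ck Ck0 _] := ediam_fin (Cd k).
  apply: ediam_le => [|_ _ [x [Ax Cx] <-] [y [Ay Cy] <-]].
    by rewrite mulr_ge0// ltW.
  by rewrite (le_trans (fg _ _ Ax Ay))// ler_pM2l// -lee_fin -Ck enorm_le_ediam.
rewrite -nneseriesZl => [|k _]; last first.
  by rewrite lee_fin exprn_ge0// fine_ge0// ediam_ge0.
apply: le_trans (hd_le s (C := D) _ _) _.
- move=> _ [x Ax <-]; have [k _ Ck] := gC (g x) (ex_intro2 _ _ x Ax erefl).
  by exists k => //; exists x.
- move=> k; have [_ _ Ckd] := ediam_fin (Cd k).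
  by rewrite (le_trans (DC k))// lee_fin mulrC -ler_pdivlMr.
- apply: lee_nneseries => k _; first by move=> _; rewrite lee_fin exprn_ge0// fine_ge0// ediam_ge0.
  have [_ D0 Dk] := ediam_fin (DC k).
  by rewrite -EFinM lee_fin -exprMn lerXn2r// nnegrE (le_trans D0 Dk).
Qed.

(** A set of diameter below [r] cannot meet both [A] and [B]. At scales below [r], each member of a
    cover of the union therefore pays for only one of the two, and its empty trace on the other
    costs [0 ^+ s.+1 = 0]. *)
Lemma hm_metric s A B (r : R) : (0 < r)%R ->
  (forall x y, A x -> B y -> r <= enorm (x - y))%R ->
  hm s A + hm s B <= hm s (A `|` B).
Proof.
move=> r0 AB.
have key d : (0 < d)%R -> hd s d A + hd s d B <= hm s (A `|` B).
  move=> d0; pose d' := Num.min d (r / 2)%R.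
  have d'0 : (0 < d')%R by rewrite lt_min d0/= divr_gt0.
  have d'd : (d' <= d)%R by rewrite ge_min lexx.
  have d'r : (d' < r)%R.
    by rewrite (@le_lt_trans _ _ (r / 2)%R) ?ge_min ?lexx ?orbT// ltr_pdivrMr//; lra.
  apply: (le_trans _ (hd_le_hm s (A `|` B) d'0)).
  apply: (@le_trans _ _ (hd s d' A + hd s d' B)); first by rewrite leeD// hd_anti.
  apply: hd_ge => C ABC Cd.
  have sub D k : ediam (C k `&` D) <= ediam (C k).
    have [Ck Ck0 _] := ediam_fin (Cd k); rewrite Ck.
    by apply: ediam_le => // x y [Cx _] [Cy _]; rewrite -lee_fin -Ck enorm_le_ediam.
  have T0 (E : set 'rV[R]_n) : (0 <= fine (ediam E))%R by rewrite fine_ge0// ediam_ge0.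
  apply: le_trans (leeD (hd_le s (C := fun k => C k `&` A) _ _)
                        (hd_le s (C := fun k => C k `&` B) _ _)) _.
  - by move=> x Ax; have [k _ Ck] := ABC x (or_introl Ax); exists k.
  - by move=> k; rewrite (le_trans (sub _ _)).
  - by move=> x Bx; have [k _ Ck] := ABC x (or_intror Bx); exists k.
  - by move=> k; rewrite (le_trans (sub _ _)).
  rewrite -nneseriesD; try by move=> k _ _; rewrite lee_fin exprn_ge0.
  apply: lee_nneseries => k _; first by move=> _; rewrite -EFinD lee_fin addr_ge0// exprn_ge0.
  have mono D : (fine (ediam (C k `&` D)) ^+ s.+1 <= fine (ediam (C k)) ^+ s.+1)%R.
    have [_ Ck0 _] := ediam_fin (Cd k).
    rewrite lerXn2r ?nnegrE//.
    have [Ck _ _] := ediam_fin (Cd k); have := sub D k; rewrite Ck => H.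
    by have [_ _] := ediam_fin H.
  rewrite -EFinD lee_fin.
  have [[x [Cx Ax]]|CA] := pselect (C k `&` A !=set0); last first.
    by rewrite (_ : C k `&` A = set0) ?ediam_set0 ?expr0n ?add0r//; exact/nonemptyPn.
  rewrite (_ : C k `&` B = set0) ?ediam_set0 ?expr0n ?addr0//.
  rewrite -subset0 => y [Cy By]; have := AB _ _ Ax By; rewrite leNgt => /negP; apply.
  by rewrite (le_lt_trans _ d'r)// -lee_fin (le_trans _ (Cd k))// enorm_le_ediam.
have [->|ABoo] := eqVneq (hm s (A `|` B)) +oo; first by rewrite leey.
have fAB : hm s (A `|` B) \is a fin_num by rewrite ge0_fin_numE ?hm_ge0// ltey.
have fE E : E `<=` A `|` B -> hm s E \is a fin_num.
  by move=> EAB; rewrite ge0_fin_numE ?hm_ge0// (le_lt_trans (hm_mono s EAB))// ltey.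
have fA := fE _ (@subsetUl _ A B); have fB := fE _ (@subsetUr _ A B).
rewrite -leeBrDr//; apply: hm_le => d1 d10.
have fd : hd s d1 A \is a fin_num.
  rewrite ge0_fin_numE ?hd_ge0// (le_lt_trans (hd_le_hm _ _ d10))//.
  by rewrite -ge0_fin_numE ?hm_ge0.
rewrite leeBrDr// addeC -leeBrDr//; apply: hm_le => d2 d20; rewrite leeBrDr// addeC.
(* The two suprema range over independent scales; as [hd] is nonincreasing in the scale, the smaller
   one serves both. *)
have d0 : (0 < Num.min d1 d2)%R by rewrite lt_min d10.
by apply: (le_trans _ (key _ d0)); rewrite leeD// hd_anti// ge_min lexx ?orbT.
Qed.

End Hausdorff.

(** * Borel sets are measurable for the Hausdorff measure *)

Section Borel.
Variables (R : realType) (n : nat).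
Implicit Types (A B C F X : set 'rV[R]_n).
Local Open Scope ereal_scope.

(* Every other shell is at positive distance from the previous ones. *)
Lemma hm_shells s X (T : nat -> set 'rV[R]_n) (d : nat -> R) :
  (forall k, T k `<=` X) -> {homo T : i j / (i <= j)%N >-> i `<=` j} ->
  (forall k, d k.+1 < d k)%R ->
  (forall k x y, T k x -> X y -> ~ T k.+1 y -> d k - d k.+1 <= enorm (x - y))%R ->
  forall e N, \sum_(k < N) hm s (T (k.*2 + e)%N.+1 `\` T (k.*2 + e)%N) <= hm s X.
Proof.
move=> TX Tmono dd Td e N; pose Rk k := T (k.*2 + e)%N.+1 `\` T (k.*2 + e)%N.
have RX k : Rk k `<=` X by move=> x [/TX].
suff H : \sum_(k < N) hm s (Rk k) <= hm s (\bigcup_(k < N) Rk k).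
  by apply: le_trans H _; apply: hm_mono => x [k _ /RX].
elim: N => [|N IH]; first by rewrite big_ord0 hm_ge0.
rewrite big_ord_recr/=; apply: le_trans (leeD2r _ IH) _.
rewrite IIS bigcup_setU bigcup_set1.
case: N {IH} => [|N].
  by rewrite II0 bigcup_set0 hm_set0 set0U add0e.
have d0 : (0 < d (N.*2 + e)%N.+1 - d (N.*2 + e)%N.+2)%R by rewrite subr_gt0.
apply: (hm_metric s d0) => x y [k kN [Tx _]] Ry.
apply: Td; [|exact: RX Ry|].
  by apply: Tmono Tx; rewrite ltnS leq_add2r leq_double.
by case: Ry => _; rewrite doubleS !addSn.
Qed.

Lemma closed_caratheodory s F : closed F ->
  (hm s : set 'rV[R]_n -> _).-caratheodory F.
Proof.
move=> cF; apply: le_caratheodory_measurable => X /=.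
have [->|Xoo] := eqVneq (hm s X) +oo; first by rewrite leey.
pose d k : R := k.+1%:R^-1%R.
pose T k := [set x | X x /\ forall y, F y -> (d k <= enorm (x - y))%R].
have d_gt0 k : (0 < d k)%R by rewrite invr_gt0.
have dd k : (d k.+1 < d k)%R by rewrite ltf_pV2 ?posrE// ltr_nat.
have TX k : T k `<=` X by move=> x [].
have Tmono : {homo T : i j / (i <= j)%N >-> i `<=` j}.
  move=> i j ij x [Xx Tx]; split=> // y Fy; rewrite (le_trans _ (Tx y Fy))//.
  by rewrite lef_pV2 ?posrE// ler_nat.
have Td k x y : T k x -> X y -> ~ T k.+1 y -> (d k - d k.+1 <= enorm (x - y))%R.
  move=> [_ Tx] Xy Ty.
  have [z [Fz yz]] : exists z, F z /\ (enorm (y - z) < d k.+1)%R.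
    apply: contrapT => H; apply: Ty; split=> // z Fz.
    by rewrite leNgt; apply/negP => yz; apply: H; exists z.
  have := Tx z Fz; have := enorm_dist x y z; lra.
pose Rk e k := T (k.*2 + e)%N.+1 `\` T (k.*2 + e)%N.
pose f k := hm s (Rk 0%N k) + hm s (Rk 1%N k).
have f0 k : 0 <= f k by rewrite adde_ge0// hm_ge0.
have foo : \sum_(0 <= k <oo) f k < +oo.
  apply: (@le_lt_trans _ _ (hm s X + hm s X)).
    apply: nneseries_le => // N; rewrite big_split/=.
    by rewrite leeD// (hm_shells s TX Tmono dd Td).
  by rewrite lte_add_pinfty// ltey.
have TF k : hm s (X `&` F) + hm s (T k) <= hm s X.
  rewrite addeC; apply: le_trans (hm_metric s (d_gt0 k) _) _ => [x y [_ Tx] [_ Fy]|].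
    exact: Tx.
  by apply: hm_mono => x [/TX|[]].
(* As [F] is closed, each point of [X] off [F] lies in some [T k]. With [k] minimal, it is in
   [T N.*2] or in a shell of index at least [N.*2]; the parity of that index decides which summand
   of [f] counts it. *)
have Xtail N : hm s (X `&` ~` F) <= hm s (T N.*2%N) + \sum_(N <= k <oo) f k.
  pose G k := Rk 0%N k `|` Rk 1%N k.
  apply: (@le_trans _ _ (hm s (T N.*2%N) + hm s (\bigcup_(k in ~` `I_N) G k))).
    apply: le_trans (outer_measureU2 (hm s) _ _); apply: hm_mono => x [Xx Fx].
    have [r r0 rF] := open_enorm_nbhs (closed_openC cF) Fx.
    have [m Tm] : exists m, T m x.
      exists (Num.trunc r^-1)%R; split=> // y Fy.
      rewrite leNgt; apply/negP; rewrite enormBC => xy; apply: rF Fy.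
      rewrite (lt_trans xy)// invf_plt ?posrE//.
      by rewrite (lt_le_trans (truncnS_gt _)).
    have [k [Tk Tk']] : exists k, T k x /\ forall j, T j x -> (k <= j)%N.
      have ex : exists m, `[< T m x >] by exists m; exact/asboolP.
      exists (ex_minn ex); case: ex_minnP => k /asboolP Tk Hk; split=> // j Tj.
      by apply: Hk; exact/asboolP.
    have [kN|Nk] := leqP k N.*2; first by left; apply: Tmono Tk.
    right; case: k Nk Tk Tk' => // k Nk Tk Tk'.
    exists k./2; first by apply/negP; rewrite -leqNgt -(doubleK N) half_leq.
    have nTk : ~ T k x by move=> /Tk'; rewrite ltnn.
    rewrite /G /Rk addn0 addn1; case: (boolP (odd k)) => ok.
      right; rewrite (_ : k./2.*2.+1 = k); first by split.
      by rewrite -{2}(odd_double_half k) ok.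
    left; rewrite (_ : k./2.*2 = k); first by split.
    by rewrite -{2}(odd_double_half k) (negbTE ok).
  rewrite leeD2l//; apply: le_trans (outer_measure_sigma_subadditive_tail _ _ _) _.
  apply: lee_nneseries => k _; first by move=> _; exact: hm_ge0.
  exact: outer_measureU2.
have fX E : E `<=` X -> hm s E \is a fin_num.
  by move=> EX; rewrite ge0_fin_numE ?hm_ge0// (le_lt_trans (hm_mono s EX))// ltey.
apply/lee_addgt0Pr => e e0.
have /fine_cvgP[_ /cvgrPdist_lt/(_ _ e0)[N _ /(_ N (leqnn N))/=]] :=
  nneseries_tail_cvg foo (fun k _ => f0 k).
rewrite sub0r normrN => /(le_lt_trans (ler_norm _)) te.
have ft : \sum_(N <= k <oo) f k \is a fin_num.
  rewrite ge0_fin_numE ?nneseries_ge0// (le_lt_trans _ foo)//.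
  by rewrite (nneseries_split 0 N) ?add0n// leeDr// sume_ge0.
apply: le_trans (leeD2l _ (Xtail N)) _; rewrite addeA leeD//.
by rewrite -(fineK ft) lee_fin ltW.
Qed.

End Borel.

Definition borelType (R : realType) (n : nat) :=
  g_sigma_algebraType (@open 'rV[R]_n).

Section BorelSets.
Variables (R : realType) (n : nat).
Local Notation V := 'rV[R]_n.
Implicit Types (A B : set V) (F : nat -> set V).

HB.instance Definition _ := Measurable.on (borelType R n).

Definition borel A := measurable (A : set (borelType R n)).

Lemma borel_open A : open A -> borel A.
Proof. exact: sub_sigma_algebra. Qed.

Lemma borelC A : borel A -> borel (~` A).
Proof. exact: measurableC. Qed.

Lemma borelI A B : borel A -> borel B -> borel (A `&` B).
Proof. exact: measurableI. Qed.

Lemma borelD A B : borel A -> borel B -> borel (A `\` B).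
Proof. exact: measurableD. Qed.

Lemma borel_bigcup F : (forall k, borel (F k)) -> borel (\bigcup_k F k).
Proof. by move=> bF; apply: (@bigcupT_measurable _ (borelType R n)). Qed.

Lemma borel_closed A : closed A -> borel A.
Proof. by move=> cA; rewrite -(setCK A); apply: borelC; apply: borel_open; exact: closed_openC. Qed.

Lemma borel0 : borel set0.
Proof. exact: measurable0. Qed.

Lemma measurable_continuous (f : V -> V) : continuous f ->
  measurable_fun setT (f : borelType R n -> borelType R n).
Proof.
move=> cf; apply: (@measurability _ _ (borelType R n) (borelType R n) setT f (@open V)) => //.
by move=> _ [U oU <-]; rewrite setTI; apply: borel_open; exact: open_comp.
Qed.

Lemma borel_preimage (f : V -> V) A : continuous f -> borel A -> borel (f @^-1` A).
Proof.
by move=> cf bA; rewrite -[_ @^-1` _]setTI; exact: (measurable_continuous cf).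
Qed.

Lemma borel_fun_le (f g : V -> R) : continuous f -> continuous g ->
  borel [set x | f x <= g x].
Proof.
move=> cf cg; apply: borel_closed.
rewrite (_ : mkset _ = (fun x => f x - g x) @^-1` [set t | t <= 0]); last first.
  by apply/funext => x; rewrite /= subr_le0.
apply: closed_comp; last exact: closed_le.
by move=> x _; apply: continuous_funB.
Qed.

Lemma borel_fun_lt (f g : V -> R) : continuous f -> continuous g ->
  borel [set x | f x < g x].
Proof.
move=> cf cg; rewrite (_ : mkset _ = ~` [set x | g x <= f x]).
  by apply: borelC; exact: borel_fun_le.
by apply/seteqP; split=> x /=; rewrite real_ltNge ?num_real// => /negP.
Qed.

Lemma borel_fun_eq (f g : V -> R) : continuous f -> continuous g ->
  borel [set x | f x = g x].
Proof.
move=> cf cg; rewrite (_ : mkset _ = [set x | f x <= g x] `&` [set x | g x <= f x]).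
  by apply: borelI; exact: borel_fun_le.
apply/seteqP; split=> x /= => [->|[fg gf]]; first by rewrite lexx.
by apply/eqP; rewrite eq_le fg.
Qed.

Lemma borel_caratheodory s A : borel A -> (hm s : set V -> _).-caratheodory A.
Proof.
move=> bA; apply: (smallest_sub _ _ bA).
  by have := @sigma_algebra_measurable _ (caratheodory_type (hm s : set V -> \bar R)).
move=> U oU; rewrite -(setCK U); apply: caratheodory_measurable_setC.
by apply: closed_caratheodory; exact: open_closedC.
Qed.

Lemma hm_split s A X : borel A -> (hm s X = hm s (X `&` A) + hm s (X `\` A))%E.
Proof. by move=> bA; rewrite (borel_caratheodory s bA X) setDE. Qed.

Lemma hm_semi_sigma_additive s :
  semi_sigma_additive (hm s : set (borelType R n) -> \bar R).
Proof.
move=> F mF tF mUF.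
apply: (@caratheodory_measure_sigma_additive _ _ (hm s : set V -> \bar R) F) => //.
  by move=> k; exact: borel_caratheodory (mF k).
exact: borel_caratheodory mUF.
Qed.

(** A copy of [hm] that carries the measure structure, as [hm] itself is registered as an outer
    measure. *)
Definition hb s (A : set (borelType R n)) := hm s (A : set V).

HB.instance Definition _ s := isMeasure.Build _ (borelType R n) R (hb s)
  (@hm_set0 R n s) (@hm_ge0 R n s) (@hm_semi_sigma_additive s).

Lemma hm_bigcup s F : (forall k, borel (F k)) -> trivIset setT F ->
  (hm s (\bigcup_k F k) = \sum_(0 <= k <oo) hm s (F k))%E.
Proof.
move=> bF tF; apply/esym/cvg_lim => //; apply: hm_semi_sigma_additive => //.
exact: borel_bigcup.
Qed.

End BorelSets.

(** * Cauchy's equation, and measure bounds for images from local ones *)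

(** Nonnegativity makes [f] monotone. Enclosing [k * a] between consecutive integers then bounds [k]
    times the defect by [f t] for every [k], so the defect is zero. *)
Lemma ge0_additive_homogeneous (R : realType) (f : R -> R) :
  (forall t, 0 <= t -> 0 <= f t) ->
  (forall s t, 0 <= s -> 0 <= t -> f (s + t) = f s + f t) ->
  forall a t, 0 <= a -> 0 <= t -> f (a * t) = a * f t.
Proof.
move=> f0 fD a t a0 t0.
have fle x y : 0 <= x -> x <= y -> f x <= f y.
  move=> x0 xy; rewrite -(subrK x y) addrC fD ?subr_ge0// lerDl f0// subr_ge0//.
have fn k x : 0 <= x -> f (k%:R * x) = k%:R * f x.
  move=> x0; elim: k => [|k IH].
    by rewrite !mul0r; have := fD 0 0 (lexx _) (lexx _); rewrite addr0; lra.
  by rewrite -natr1 !mulrDl !mul1r fD ?IH// mulr_ge0.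
have bound k : `|k%:R * (f (a * t) - a * f t)| <= f t.
  have ka : 0 <= k%:R * a by rewrite mulr_ge0.
  have /andP[p1 p2] := truncn_itv ka; set p := Num.trunc _ in p1 p2.
  have at0 : 0 <= a * t by rewrite mulr_ge0.
  have h1 : p%:R * f t <= k%:R * f (a * t).
    by rewrite -!fn//; apply: fle; rewrite ?mulr_ge0// mulrA ler_wpM2r.
  have h2 : k%:R * f (a * t) <= p.+1%:R * f t.
    by rewrite -!fn//; apply: fle; rewrite ?mulr_ge0// mulrA ler_wpM2r// ltW.
  have ft := f0 _ t0; have q1 := ler_wpM2r ft p1; have q2 := ler_wpM2r ft (ltW p2).
  rewrite -natr1 mulrDl mul1r in h2 q2.
  by rewrite ler_norml mulrBr mulrA; apply/andP; split; lra.
apply/eqP; rewrite -subr_eq0 -normr_le0 leNgt; apply/negP => d0.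
have := bound (Num.trunc (f t / `|f (a * t) - a * f t|)).+1.
rewrite normrM normr_nat leNgt => /negP; apply.
by rewrite -ltr_pdivrMr// truncnS_gt.
Qed.

Section Glue.
Variables (R : realType) (n s : nat) (f : 'rV[R]_n -> 'rV[R]_n).
Local Open Scope ereal_scope.

(** After the cover is made disjoint, additivity is used only for the Borel pieces of [A]. Their
    images may overlap and need not be Borel; subadditivity is enough for them. *)
Lemma hm_image_glue (l : R) (A : set 'rV[R]_n) (U : nat -> set 'rV[R]_n) :
  (0 <= l)%R -> borel A -> (forall k, borel (U k)) -> A `<=` \bigcup_k U k ->
  (forall k B, borel B -> B `<=` A `&` U k -> hm s (f @` B) <= l%:E * hm s B) ->
  hm s (f @` A) <= l%:E * hm s A.
Proof.
move=> l0 bA bU AU H; pose B k := A `&` seqDU U k.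
have bB k : borel (B k).
  apply: borelI => //; rewrite /seqDU; apply: borelD => //.
  by apply: (@bigsetU_measurable _ (borelType R n)) => i _; exact: bU.
have AB : A = \bigcup_k B k by rewrite -setI_bigcupr -seqDU_bigcup_eq; apply/esym/setIidPl.
have tB : trivIset setT B by apply: trivIset_setIl; exact: trivIset_seqDU.
rewrite {2}AB (hm_bigcup s bB tB) -nneseriesZl; last by move=> k _; exact: hm_ge0.
rewrite AB image_bigcup; apply: le_trans (hm_sigma_subadditive s _) _.
apply: lee_nneseries => k _; first by move=> _; exact: hm_ge0.
apply: (H k) => // x [Ax Ux]; split=> //; exact: subset_seqDU Ux.
Qed.

(** The slack [L] absorbs the error of linearization near a point. Balls with rational centers and
    radii [1 / (k + 1)] are countably many, so those on which the bound with slack holds can be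
    glued; then [L] tends to 1. *)
Lemma hm_image_local (l : R) (A : set 'rV[R]_n) : (0 < l)%R -> borel A ->
  (forall (L : R) p, (1 < L)%R -> A p -> exists2 U : set 'rV[R]_n, open U & U p /\
     forall B, borel B -> B `<=` A `&` U -> hm s (f @` B) <= (L * l)%:E * hm s B) ->
  hm s (f @` A) <= l%:E * hm s A.
Proof.
move=> l0 bA H.
have HL (L : R) : (1 < L)%R -> hm s (f @` A) <= (L * l)%:E * hm s A.
  move=> L1; pose bl (qk : 'rV[rat]_n * nat) :=
    [set x : 'rV[R]_n | (enorm (x - map_mx ratr qk.1) < qk.2.+1%:R^-1)%R].
  pose good (W : set 'rV[R]_n) := forall B, borel B -> B `<=` A `&` W ->
    hm s (f @` B) <= (L * l)%:E * hm s B.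
  pose U k := if unpickle k is Some qk then
    if pselect (good (bl qk)) then bl qk else set0 else set0.
  apply: (hm_image_glue (U := U)) => //.
  - by rewrite mulr_ge0// ltW// (lt_trans _ L1).
  - move=> k; rewrite /U; case: unpickle => [qk|]; last exact: borel0.
    case: pselect => [?|?] /=; last exact: borel0.
    by apply: borel_open; exact: open_enorm_ball.
  - move=> p Ap; have [W oW [Wp WB]] := H L p L1 Ap.
    have [r r0 rW] := open_enorm_nbhs oW Wp.
    pose k := Num.trunc (2 / r)%R.
    (* Any ball of radius [1 / (k + 1)] that contains [p] then lies within distance [r] of [p]. *)
    have kr : (2 * k.+1%:R^-1 < r)%R.
      by rewrite ltr_pdivrMr// mulrC -ltr_pdivrMr// truncnS_gt.
    have [q pq] : exists q : 'rV[rat]_n, (enorm (p - map_mx ratr q) < k.+1%:R^-1)%R.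
      have k0 : (0 < k.+1%:R^-1 :> R)%R by rewrite invr_gt0.
      have := @open_enorm_ball R n p k.+1%:R^-1%R.
      rewrite openE => /(_ p) /=; rewrite subrr enorm0 => /(_ k0) /nbhs_ballP[d /= d0 dB].
      have dQ (j : 'I_n) : exists q : rat, (`|p ord0 j - ratr q| < d)%R.
        have : (p ord0 j - d < p ord0 j + d)%R by lra.
        move=> /rat_in_itvoo[q]; rewrite in_itv/= => /andP[q1 q2].
        by exists q; rewrite ltr_norml; apply/andP; split; lra.
      have [q pq] := choice dQ.
      exists (\row_j q j)%R; rewrite enormBC; apply: dB; split=> // i j.
      by rewrite ord1 /ball/= !mxE.
    exists (pickle (q, k)) => //; rewrite /U pickleK.
    case: pselect => [?|[]] // B bB BW; apply: WB => // x Bx.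
    have [Ax bx] := BW x Bx; split=> //; apply: rW.
    rewrite /bl/= in bx; have := enorm_dist x (map_mx ratr q) p.
    rewrite (enormBC (map_mx _ _) p); move: kr pq bx; set z := (_^-1)%R; lra.
  - move=> k B bB; rewrite /U; case: unpickle => [qk|].
      case: pselect => [gqk|?] /=; first exact: gqk.
      rewrite setI0 subset0 => ->; rewrite image_set0 hm_set0 mule_ge0//.
      by rewrite lee_fin mulr_ge0// ltW// (lt_trans _ L1).
    rewrite setI0 subset0 => ->; rewrite image_set0 hm_set0 mule_ge0//.
    by rewrite lee_fin mulr_ge0// ltW// (lt_trans _ L1).
have [->|Aoo] := eqVneq (hm s A) +oo; first by rewrite gt0_muley ?leey// lte_fin.
have fA : hm s A \is a fin_num by rewrite ge0_fin_numE ?hm_ge0// ltey.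
apply/lee_addgt0Pr => e e0.
pose y := fine (hm s A); have y0 : (0 <= y)%R by rewrite fine_ge0// hm_ge0.
(* The excess [d * l * y] stays below [e]; the summand 1 keeps the quotient meaningful when
   [y = 0]. *)
pose d := (e / (l * (y + 1)))%R.
have ly0 : (0 < l * (y + 1))%R by rewrite mulr_gt0//; lra.
have d0 : (0 < d)%R by rewrite divr_gt0.
have L1 : (1 < 1 + d)%R by lra.
apply: le_trans (HL _ L1) _; rewrite -(fineK fA) -/y -!EFinM -EFinD lee_fin.
have -> : ((1 + d) * l * y = l * y + d * (l * y))%R by ring.
rewrite lerD2l (@le_trans _ _ (d * (l * (y + 1)))%R)//.
  by rewrite ler_pM2l// ler_pM2l//; lra.
by rewrite /d divfK// gt_eqF.
Qed.

End Glue.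

(** * Scaling one direction of a hyperplane *)

Section Stretch.
Variables (R : realType) (n : nat).
Local Notation V := 'rV[R]_n.
Implicit Types (e u x y : V) (a b h : R) (W A : set V).

(* For a unit vector [e]: the component along [e] is multiplied by [a]; hence
   [stretch e 0] is the orthogonal projection along [e]. *)
Definition stretch e a x : V := x + ((a - 1) * dotv x e) *: e.

Lemma continuous_stretch e a : continuous (stretch e a).
Proof.
apply: continuous_funD => //; apply: continuous_funZ => //.
exact: continuous_funM.
Qed.

Section Unit.
Variable e : V.
Hypothesis e1 : dotv e e = 1.

Lemma dotv_stretch a x : dotv (stretch e a x) e = a * dotv x e.
Proof. by rewrite /stretch !dotvE e1; ring. Qed.

Lemma stretch_comp a b x : stretch e a (stretch e b x) = stretch e (a * b) x.
Proof.
rewrite {1}/stretch dotv_stretch /stretch -addrA -scalerDl.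
by congr (_ + _ *: _); ring.
Qed.

Lemma stretch1 x : stretch e 1 x = x.
Proof. by rewrite /stretch subrr mul0r scale0r addr0. Qed.

Lemma stretchK a : a != 0 -> cancel (stretch e a) (stretch e a^-1).
Proof. by move=> a0 x; rewrite stretch_comp mulVf// stretch1. Qed.

Lemma stretchVK a : a != 0 -> cancel (stretch e a^-1) (stretch e a).
Proof. by move=> a0 x; rewrite stretch_comp mulfV// stretch1. Qed.

Lemma stretch_decomp x : x = stretch e 0 x + dotv x e *: e.
Proof. by rewrite /stretch sub0r mulN1r scaleNr subrK. Qed.

Lemma stretchD a x t : stretch e a (x + t *: e) = stretch e a x + (a * t) *: e.
Proof.
rewrite /stretch !dotvE e1 -!addrA; congr (_ + _); rewrite -!scalerDl.
by congr (_ *: _); ring.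
Qed.

Lemma sqr_stretch a x :
  dotv (stretch e a x) (stretch e a x) = dotv x x - (1 - a ^+ 2) * dotv x e ^+ 2.
Proof. by rewrite /stretch !dotvE e1 (dotvC e); ring. Qed.

End Unit.

Lemma hm_translate s (v : V) A : hm s ((fun x => x + v) @` A) = hm s A.
Proof.
have tr B (w : V) : (hm s ((fun x => (x + w)%R) @` B) <= hm s B)%E.
  have := @hm_lipschitz R n s 1 B (fun x => x + w) id ltr01.
  rewrite expr1n mul1e image_id; apply=> x y _ _.
  by rewrite mul1r opprD addrACA subrr addr0.
apply/eqP; rewrite eq_le tr/=.
apply: le_trans (tr ((fun x => x + v) @` A) (- v)).
by apply: hm_mono => x Ax; exists (x + v); [exists x|rewrite addrK].
Qed.

(** Half-open in the direction [e], so that consecutive strips over the same base are disjoint and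
    fill the longer strip. *)
Definition strip e a b W :=
  [set x | a <= dotv x e] `&` [set x | dotv x e < b] `&` (stretch e 0 @^-1` W).

Lemma borel_strip e a b W : borel W -> borel (strip e a b W).
Proof.
move=> bW; apply: borelI; last by apply: borel_preimage => //; exact: continuous_stretch.
by apply: borelI; [apply: borel_fun_le|apply: borel_fun_lt].
Qed.

Section HmStretch.
Variables (s : nat) (u e : V) (h : R).
Hypothesis e1 : dotv e e = 1.
Hypothesis ue : dotv u e = 0.
Let H := [set x | dotv u x = h].
Hypothesis Hfin : forall r : R, (hm s (H `&` [set x | (enorm x <= r)%R]) < +oo)%E.

Let bH : borel H.
Proof. exact: borel_fun_eq. Qed.

Let H_stretch a x : H (stretch e a x) = H x.
Proof. by rewrite /H /stretch/= !dotvE ue mulr0 addr0. Qed.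

Let strip_fin a b W r : (forall x, W x -> enorm x <= r) ->
  (hm s (H `&` strip e a b W) < +oo)%E.
Proof.
move=> Wr; apply: le_lt_trans (Hfin (r + (`|a| + `|b|))); apply: hm_mono.
move=> x [Hx [[/= ax xb] /Wr xr]]; split=> //=.
rewrite (stretch_decomp e x) (le_trans (enormD _ _))// lerD//.
rewrite enormZ (_ : enorm e = 1) ?mulr1; last by rewrite /enorm e1 sqrtr1.
have := ler_norm b; have := ler_norm (- a); have := normr_ge0 a; have := normr_ge0 b.
by rewrite normrN ler_norml => *; apply/andP; split; lra.
Qed.

Let strip_translate a b t W :
  hm s (H `&` strip e (a + t) (b + t) W) = hm s (H `&` strip e a b W).
Proof.
rewrite -(hm_translate s (t *: e) (_ `&` strip e a b W)); congr (hm s _).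
have dx x : dotv (x + t *: e) e = dotv x e + t by rewrite !dotvE e1 mulr1.
have ux x : dotv u (x + t *: e) = dotv u x by rewrite !dotvE ue mulr0 addr0.
have sx x : stretch e 0 (x + t *: e) = stretch e 0 x.
  by rewrite stretchD// mul0r scale0r addr0.
apply/seteqP; split => [x|_ [x [/= Hx [[/= ax xb] Wx]] <-]].
  pose y := x - t *: e; have E : x = y + t *: e by rewrite subrK.
  rewrite E => -[]; rewrite /H/= ux => Hy []; rewrite /strip/= dx sx => -[ay yb] Wy.
  by exists y => //; split=> //; split=> //; split=> /=; lra.
rewrite /H/= ux; split=> //; split; last by rewrite /= sx.
by rewrite /= dx; split; lra.
Qed.

(** The measure of the strip over [[0, t)] is additive in [t]: cut at [x], then translate the second
    piece back along [e]. It is finite because the base is bounded, so [ge0_additive_homogeneous]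
    applies to its real value. *)
Let hm_strip_scale a b c W r : 0 < a -> open W -> (forall x, W x -> enorm x <= r) ->
  hm s (H `&` strip e (a * b) (a * c) W) = (a%:E * hm s (H `&` strip e b c W))%E.
Proof.
move=> a0 oW Wr.
have [cb|bc] := leP c b.
  have z (t1 t2 : R) : t2 <= t1 -> strip e t1 t2 W = set0.
    by move=> t21; rewrite -subset0 => p [[/= tp pt] _]; move: t21 tp pt; lra.
  by rewrite !z ?setI0 ?hm_set0 ?mule0// ler_pM2l.
pose f t := fine (hm s (H `&` strip e 0 t W)).
have fE t : hm s (H `&` strip e 0 t W) = (f t)%:E.
  by rewrite fineK// ge0_fin_numE ?hm_ge0// (strip_fin _ _ Wr).
have f0 t : 0 <= t -> 0 <= f t by move=> _; rewrite fine_ge0// hm_ge0.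
have fD (x y : R) : 0 <= x -> 0 <= y -> f (x + y) = f x + f y.
  move=> x0 y0; apply: EFin_inj; rewrite EFinD -!fE.
  have bE : borel [set z | dotv z e < x].
    exact: borel_fun_lt.
  rewrite (hm_split s _ bE); congr (_ + _)%E.
    congr (hm s _); apply/seteqP; split => z /=; rewrite /strip/=; first tauto.
    by move=> [Hz [[z0 zx] Wz]]; do ![split=> //]; lra.
  rewrite -(strip_translate 0 y x); congr (hm s _).
  rewrite add0r (addrC y); apply/seteqP; split => z /=; rewrite /strip/=.
    by move=> [[Hz [[z0 zx] Wz]] /negP]; rewrite -leNgt.
  move=> [Hz [[z0 zx] Wz]]; split; last by apply/negP; rewrite -leNgt.
  by do ![split=> //]; lra.
have := ge0_additive_homogeneous f0 fD (ltW a0) (t := c - b).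
rewrite subr_ge0 => /(_ (ltW bc)) fac.
have -> : strip e b c W = strip e (0 + b) ((c - b) + b) W by rewrite add0r subrK.
have -> : strip e (a * b) (a * c) W = strip e (0 + a * b) (a * (c - b) + a * b) W.
  by rewrite add0r -mulrDr subrK.
by rewrite !strip_translate !fE -EFinM fac.
Qed.

(* Strips form a pi-system that generates the Borel sets, so two measures that
   agree on strips agree on all Borel sets. *)
Let G : set (set V) := [set A | exists a b W r, [/\ open W,
  (forall x, W x -> enorm x <= r) & A = strip e a b W]].

Let borel_G A : borel A -> <<s G >> A.
Proof.
move=> bA; have GT := @bigcupT_measurable _ (g_sigma_algebraType G).
apply: (smallest_sub _ _ bA); first exact: smallest_sigma_algebra.
move=> U oU.
(* For given endpoints and norm bound, all admissible bases are merged into one. Only two rationals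
   and an integer remain to be enumerated, and the base space needs no countable basis. *)
pose W (k : rat * rat * nat) : set V := \bigcup_(B in [set B : set V |
  [/\ open B, (forall x, B x -> enorm x <= k.2%:R) &
   strip e (ratr k.1.1) (ratr k.1.2) B `<=` U]]) B.
have -> : U = \bigcup_k strip e (ratr k.1.1) (ratr k.1.2) (W k).
  apply/seteqP; split => [x Ux|x [k _ [xk [B [_ _ BU] Bx]]]]; last exact: BU.
  have [r r0 rU] := open_enorm_nbhs oU Ux.
  have /rat_in_itvoo[q] : dotv x e - r / 2 < dotv x e by lra.
  rewrite in_itv/= => /andP[q1 q2].
  have /rat_in_itvoo[q'] : dotv x e < dotv x e + r / 2 by lra.
  rewrite in_itv/= => /andP[q'1 q'2].
  pose B := [set y | enorm (y - stretch e 0 x) < r / 2].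
  have BK y : B y -> enorm y <= enorm (stretch e 0 x) + r / 2.
    by rewrite /B/= => yr; have := enormD (y - stretch e 0 x) (stretch e 0 x); rewrite subrK; lra.
  exists (q, q', (Num.trunc (enorm (stretch e 0 x) + r / 2)).+1) => //.
  split; first by split=> /=; rewrite ?ltW.
  exists B; last by rewrite /B/= subrr enorm0; lra.
  split; first exact: open_enorm_ball.
    move=> y /BK /le_trans; apply; exact/ltW/truncnS_gt.
  move=> y [[/= qy yq'] By]; apply: rU.
  rewrite {1}(stretch_decomp e y) {1}(stretch_decomp e x) opprD addrACA -scalerBl.
  apply: le_lt_trans (enormD _ _) _.
  rewrite enormZ (_ : enorm e = 1) ?mulr1; last by rewrite /enorm e1 sqrtr1.
  have : `|dotv y e - dotv x e| <= r / 2 by rewrite ler_norml; apply/andP; split; lra.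
  by move: By; rewrite /B/=; lra.
apply: (@countable_bigcupT_measurable _ (g_sigma_algebraType G)) => // k.
apply: sub_sigma_algebra; exists (ratr k.1.1), (ratr k.1.2), (W k), k.2%:R; split=> //.
  by apply: bigcup_open => B [].
by move=> x [B [_ + _]]; exact.
Qed.

(** Compared are [m1], the measure on [H], and [m2], which is [a^-1] times the pushforward of [m1]
    under [stretch e a^-1]. They agree on strips by [hm_strip_scale], and the strips [g k] of finite
    measure exhaust the space, so they agree on [A]. *)
Lemma hm_stretch a A : 0 < a -> borel A -> A `<=` H ->
  hm s (stretch e a @` A) = (a%:E * hm s A)%E.
Proof.
move=> a0 bA AH.
have a_neq0 : a != 0 by rewrite gt_eqF.
pose S := stretch e a^-1.
have cS : continuous S by exact: continuous_stretch.
have mS : measurable_fun setT (S : borelType R n -> borelType R n).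
  exact: measurable_continuous.
have Vge0 : 0 <= a^-1 by rewrite invr_ge0 ltW.
pose m1 : {measure set (borelType R n) -> \bar R} := mrestr (hb s) bH.
have push_additive : semi_sigma_additive
    (fun B : set (borelType R n) => m1 (S @^-1` B)).
  have := @measure_semi_sigma_additive _ _ _ m1 => add F mF tF mUF.
  rewrite preimage_bigcup; apply: add => [k||].
  - by rewrite -[X in measurable X]setTI; exact: mS.
  - apply/trivIsetP => i j _ _ ij; rewrite -preimage_setI.
    by move/trivIsetP : tF => /(_ _ _ _ _ ij) ->//; rewrite preimage_set0.
  - by rewrite -preimage_bigcup -[X in measurable X]setTI; exact: mS.
pose m' : {measure set (borelType R n) -> \bar R} :=
  HB.pack (fun B : set (borelType R n) => m1 (S @^-1` B))
  (isMeasure.Build _ (borelType R n) R (fun B => m1 (S @^-1` B))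
    (measure0 m1) (fun B => measure_ge0 m1 _) push_additive).
pose m2 : {measure set (borelType R n) -> \bar R} := mscale (NngNum Vge0) m'.
have m1E B : m1 B = hm s (B `&` H) by [].
have m2E B : m2 B = (a^-1%:E * hm s (S @^-1` B `&` H))%E by [].
have bdd k : forall x : V, enorm (x - 0) < k%:R -> enorm x <= k%:R.
  by move=> x; rewrite subr0 => /ltW.
pose g k := strip e (- k%:R) k%:R [set x : V | enorm (x - 0) < k%:R].
have m12 B : borel B -> m1 B = m2 B.
  move=> /borel_G; apply: (@g_sigma_algebra_measure_unique _ R (borelType R n) G _ g).
  - by move=> _ [b [c [W [r [oW Wr ->]]]]]; apply: borel_strip; exact: borel_open.
  - move=> k; exists (- k%:R), k%:R, [set x : V | enorm (x - 0) < k%:R], k%:R.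
    by split; [exact: open_enorm_ball|exact: bdd|].
  - apply/seteqP; split=> // x _.
    pose k := (Num.trunc (`|dotv x e| + enorm (stretch e 0 x))).+1.
    have := truncnS_gt (`|dotv x e| + enorm (stretch e 0 x)); rewrite -/k => xk.
    have := enorm_ge0 (stretch e 0 x) => ge0.
    exists k => //; split; last by rewrite /= subr0 (le_lt_trans _ xk)// lerDr.
    have : `|dotv x e| < k%:R by rewrite (le_lt_trans _ xk)// lerDl.
    by rewrite ltr_norml => /andP[/ltW].
  - move=> _ _ [b [c [W [r [oW Wr ->]]]]] [b' [c' [W' [r' [oW' Wr' ->]]]]].
    exists (Num.max b b'), (Num.min c c'), (W `&` W'), r; split=> [||].
    + exact: openI.
    + by move=> x [/Wr].
    + apply/seteqP; split => x; rewrite /strip/= ge_max lt_min.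
        by move=> [[[-> ->] ?] [[-> ->] ?]].
      by move=> [[/andP[-> ->] /andP[-> ->]] [? ?]].
  - move=> _ [b [c [W [r [oW Wr ->]]]]].
    rewrite m1E m2E.
    have -> : S @^-1` strip e b c W = strip e (a * b) (a * c) W.
      apply/seteqP; split => x; rewrite /strip/= dotv_stretch// stretch_comp// mul0r.
        by move=> [[xb xc] Wx]; rewrite -ler_pdivlMl// -ltr_pdivrMl.
      by move=> [[xb xc] Wx]; rewrite ler_pdivlMl// ltr_pdivrMl.
    rewrite !(setIC _ H) (hm_strip_scale _ _ _ oW Wr)// muleA -EFinM mulVf//.
    by rewrite mul1e.
  - move=> k; rewrite m1E setIC.
    by apply: (@strip_fin _ _ _ k%:R); exact: bdd.
have := m12 _ bA; rewrite m1E m2E (setIidl AH).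
have -> : S @^-1` A `&` H = stretch e a @` A.
  apply/seteqP; split => [x [Ax _]|_ [x Ax <-]].
    by exists (S x) => //; exact: stretchVK.
  split; first by rewrite /preimage/= /S stretchK.
  by have := AH _ Ax; rewrite -(H_stretch a x).
by move=> ->; rewrite muleA -EFinM mulfV// mul1e.
Qed.

End HmStretch.
End Stretch.

(** * The sphere and its projections *)

Section Radial.
Variables (R : realType) (n : nat).
Local Notation V := 'rV[R]_n.
Implicit Types (u x y z : V).

Definition sphere : set V := [set x | enorm x = 1].

Lemma sphere_dotv x : sphere x <-> dotv x x = 1.
Proof.
rewrite -sqr_enorm /sphere/=; split => [->|/eqP]; first by rewrite expr1n.
by rewrite sqrf_eq1 => /orP[/eqP//|/eqP E]; have := enorm_ge0 x; rewrite E ler0N1.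
Qed.

Definition radial x : V := (enorm x)^-1 *: x.

Lemma enorm_radial x : x != 0 -> enorm (radial x) = 1.
Proof.
move=> x0; rewrite /radial enormZ ger0_norm ?invr_ge0 ?enorm_ge0// mulVf//.
by rewrite enorm_eq0.
Qed.

Lemma radial_sphere x : sphere x -> radial x = x.
Proof. by rewrite /sphere/= /radial => ->; rewrite invr1 scale1r. Qed.

Lemma radialZ a x : 0 < a -> radial (a *: x) = radial x.
Proof.
move=> a0; rewrite /radial enormZ gtr0_norm// scalerA invfM mulrAC mulVf ?gt_eqF//.
by rewrite mul1r.
Qed.

(** The right side is exactly [enorm x * enorm y] times the left side. The subtracted square is what
    [radial_contract] turns into a contraction factor below 1. *)
Lemma sqr_radialB x y : 1 <= enorm x -> 1 <= enorm y ->
  dotv (radial x - radial y) (radial x - radial y) <=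
  dotv (x - y) (x - y) - (enorm x - enorm y) ^+ 2.
Proof.
move=> x1 y1; set D := (X in X <= _).
have D0 : 0 <= D by exact: dotv_ge0.
have x0 : enorm x != 0 by rewrite gt_eqF// (lt_le_trans ltr01).
have y0 : enorm y != 0 by rewrite gt_eqF// (lt_le_trans ltr01).
have -> : dotv (x - y) (x - y) - (enorm x - enorm y) ^+ 2 = (enorm x * enorm y) * D.
  rewrite /D /radial !dotvE -!sqr_enorm (dotvC y x).
  by field; rewrite ?x0 ?y0.
by rewrite ler_peMl// mulr_ege1.
Qed.

Lemma radial_lip x y : 1 <= enorm x -> 1 <= enorm y ->
  enorm (radial x - radial y) <= enorm (x - y).
Proof.
move=> x1 y1; rewrite -ler_sqr ?nnegrE ?enorm_ge0// !sqr_enorm.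
by apply: le_trans (sqr_radialB x1 y1) _; rewrite gerBl sqr_ge0.
Qed.

(* For [z] orthogonal to the unit vector [u] with [|z| <= 1]: the point of the
   unit sphere above [z]. *)
Definition glift u z : V := z + Num.sqrt (1 - dotv z z) *: u.

Lemma stretchB u a x y : stretch u a (x - y) = stretch u a x - stretch u a y.
Proof.
rewrite /stretch opprD addrACA -scaleNr -scalerDl; congr (_ + _ *: _).
by rewrite !dotvE; ring.
Qed.

Lemma stretchZ u a c x : stretch u a (c *: x) = c *: stretch u a x.
Proof.
rewrite /stretch dotvZl scalerDr scalerA; congr (_ + _ *: _); ring.
Qed.

Section Unit.
Variable u : V.
Hypothesis u1 : dotv u u = 1.

Lemma enorm_unit : enorm u = 1. Proof. by rewrite /enorm u1 sqrtr1. Qed.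

Lemma dotv_proj x : dotv (stretch u 0 x) u = 0.
Proof. by rewrite dotv_stretch// mul0r. Qed.

Lemma sqr_proj x : dotv (stretch u 0 x) (stretch u 0 x) = dotv x x - dotv x u ^+ 2.
Proof. by rewrite sqr_stretch// expr0n subr0 mul1r. Qed.

Lemma proj_lip x y : enorm (stretch u 0 x - stretch u 0 y) <= enorm (x - y).
Proof.
rewrite -stretchB -ler_sqr ?nnegrE ?enorm_ge0// !sqr_enorm sqr_proj.
by rewrite gerBl sqr_ge0.
Qed.

Lemma dotv_glift z : dotv z u = 0 -> dotv (glift u z) u = Num.sqrt (1 - dotv z z).
Proof. by move=> zu; rewrite /glift !dotvE zu u1 add0r mulr1. Qed.

Lemma glift_sphere z : dotv z u = 0 -> dotv z z <= 1 -> sphere (glift u z).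
Proof.
move=> zu z1; apply/sphere_dotv; rewrite /glift !dotvE zu (dotvC u) zu u1.
by rewrite mulr0 mulr1 addr0 add0r -expr2 sqr_sqrtr ?subr_ge0// addrC subrK.
Qed.

Lemma proj_glift z : dotv z u = 0 -> stretch u 0 (glift u z) = z.
Proof.
move=> zu; rewrite /stretch dotv_glift// sub0r mulN1r scaleNr.
by rewrite /glift addrK.
Qed.

Lemma glift_proj x : sphere x -> 0 <= dotv x u -> glift u (stretch u 0 x) = x.
Proof.
move=> /sphere_dotv x1 xu; rewrite /glift sqr_proj x1 subKr.
by rewrite sqrtr_sqr ger0_norm// -stretch_decomp.
Qed.

Lemma continuous_glift : continuous (glift u).
Proof.
apply: continuous_funD => //; apply: continuous_funZ => //.
apply: continuous_fun_sqrt; apply: continuous_funB => //.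
by apply: (@continuous_dotv _ _ V (fun x => x) (fun x => x)).
Qed.

End Unit.
End Radial.

(** * Finiteness on the sphere and on bounded pieces of hyperplanes *)

Section Finite.
Variables (R : realType).
Local Open Scope ereal_scope.

Lemma hd_finite_cover n s (delta D : R) (I : finType) (C : I -> set 'rV[R]_n)
    (A : set 'rV[R]_n) : (0 <= D)%R -> (D <= delta)%R -> A `<=` \bigcup_i C i ->
  (forall i, ediam (C i) <= D%:E) ->
  hd s delta A <= (#|I|%:R * D ^+ s.+1)%:E.
Proof.
move=> D0 Dd AC Cd.
pose G k := if (k < #|I|)%N =P true is ReflectT p then C (enum_val (Ordinal p)) else set0.
have GD k : ediam (G k) <= D%:E.
  by rewrite /G; case: eqP => // _; rewrite ediam_set0 lee_fin.
apply: le_trans (hd_le s (C := G) _ _) _.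
- move=> x /AC[i _ Ci]; exists (enum_rank i) => //; rewrite /G.
  case: eqP => [p|]; last by rewrite ltn_ord.
  by rewrite (_ : Ordinal p = enum_rank i) ?enum_rankK//; exact: val_inj.
- by move=> k; rewrite (le_trans (GD k))// lee_fin.
rewrite (nneseries_split 0 #|I|)//; last first.
  by move=> k _; rewrite lee_fin exprn_ge0// fine_ge0// ediam_ge0.
rewrite add0n [X in _ + X]eseries0 ?adde0; last first.
  move=> k Ik _; rewrite /G; case: eqP => [p|_]; first by have := p; rewrite ltnNge Ik.
  by rewrite ediam_set0 expr0n.
rewrite sumEFin lee_fin; apply: (@le_trans _ _ (\sum_(0 <= k < #|I|) D ^+ s.+1)%R).
  apply: ler_sum => k _; have [_ f0 fD] := ediam_fin (GD k).
  by rewrite lerXn2r ?nnegrE.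
by rewrite sumr_const_nat subn0 mulr_natl.
Qed.

(** The face is cut into [k.+1 ^ s.+1] cubes of side [2 / k.+1]. Their diameter is at most [s.+1]
    times the side, a crude form of the factor [sqrt s.+1], so the total cost does not depend on
    [k]. *)
Lemma hm_face_fin s (j : 'I_s.+2) (c : R) :
  hm s [set x : 'rV[R]_s.+2 | x ord0 j = c /\ forall i, (`|x ord0 i| <= 1)%R] < +oo.
Proof.
set A := [set x | _].
suff: hm s A <= ((2 * s.+1%:R) ^+ s.+1)%:E by move/le_lt_trans; apply; exact: ltry.
apply: hm_le => d d0.
pose k := Num.trunc ((2 * s.+1%:R) / d)%R.
pose D : R := ((2 * s.+1%:R) / k.+1%:R)%R.
have k0 : (0 < k.+1%:R :> R)%R by [].
have Dd : (D <= d)%R.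
  by rewrite ler_pdivrMr// (mulrC d) -ler_pdivrMr//; exact/ltW/truncnS_gt.
have D0 : (0 <= D)%R by rewrite divr_ge0// mulr_ge0.
pose P (g : {ffun 'I_s.+1 -> 'I_k.+1}) := [set x : 'rV[R]_s.+2 | x ord0 j = c /\
  forall i, ((g i)%:R <= (x ord0 (lift j i) + 1) / 2 * k.+1%:R <= (g i)%:R + 1)%R].
apply: le_trans (hd_finite_cover (C := P) s D0 Dd _ _) _.
- move=> x [xj x1].
  pose t i := ((x ord0 (lift j i) + 1) / 2 * k.+1%:R)%R.
  (* Truncation returns [k.+1] only at the end where the coordinate is 1; the minimum puts that end
     into the last cell, which is closed. *)
  exists [ffun i => inord (minn (Num.trunc (t i)) k)] => //; split=> // i.
  rewrite ffunE inordK ?ltnS ?geq_minr// -/(t i).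
  have := x1 (lift j i); rewrite ler_norml => /andP[xl xu].
  have t0 : (0 <= t i)%R by rewrite mulr_ge0// divr_ge0//; lra.
  have tk : (t i <= k.+1%:R)%R by rewrite ler_piMl//; lra.
  have /andP[t1 t2] := truncn_itv t0.
  rewrite /minn; case: ifPn => [_|]; first by rewrite t1 natr1 ltW.
  rewrite -leqNgt => kt; rewrite natr1 tk andbT.
  by rewrite (le_trans _ t1)// ler_nat.
- move=> g; apply: ediam_le => // x y [xj Px] [yj Py].
  rewrite -ler_sqr ?nnegrE ?enorm_ge0// sqr_enorm /dotv.
  rewrite (bigD1_ord j)//= !mxE xj yj subrr mul0r add0r.
  apply: (@le_trans _ _ (\sum_(i < s.+1) (2 / k.+1%:R) ^+ 2)%R).
    apply: ler_sum => i _; rewrite !mxE -expr2.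
    have := Px i; have := Py i; move: k0; set K : R := k.+1%:R => k0.
    move=> /andP[y1 y2] /andP[x1 x2].
    have h1 : (x ord0 (lift j i) - y ord0 (lift j i) <= 2 / K)%R.
      by rewrite ler_pdivlMr//; lra.
    have h2 : (- (2 / K) <= x ord0 (lift j i) - y ord0 (lift j i))%R.
      by rewrite lerNl ler_pdivlMr//; lra.
    move: h1 h2; set a := (_ - _)%R; set b := (2 / K)%R => h1 h2.
    by rewrite -subr_ge0 subr_sqr mulr_ge0//; lra.
  rewrite sumr_const card_ord -[leLHS]mulr_natl.
  have -> : D = (s.+1%:R * (2 / k.+1%:R))%R by rewrite /D mulrCA mulrA.
  rewrite [leRHS]exprMn ler_wpM2r ?sqr_ge0//.
  by rewrite -natrX ler_nat -mulnn leq_pmulr.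
- rewrite card_ffun !card_ord natrX /D lee_fin -exprMn.
  by rewrite mulrCA mulfV ?mulr1// gt_eqF.
Qed.
(** The sphere is the radial image of the boundary of the cube. Points there have norm at least 1,
    where [radial] is 1-Lipschitz; the coordinate of largest absolute value selects the face. *)
Lemma hm_sphere_fin s : hm s (@sphere R s.+2) < +oo.
Proof.
pose V := 'rV[R]_s.+2.
pose face (j : 'I_s.+2) (c : R) := [set x : V | x ord0 j = c /\ forall i, (`|x ord0 i| <= 1)%R].
pose F j := (@radial R s.+2 @` face j 1%R) `|` (@radial R s.+2 @` face j (- 1)%R).
have norm1 j c x : (`|c| = 1)%R -> face j c x -> (1 <= enorm x)%R.
  by move=> c1 [xj _]; rewrite -c1 -xj coord_le_enorm.
have radial_face_fin j c : (`|c| = 1)%R -> hm s (@radial R s.+2 @` face j c) < +oo.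
  move=> c1; apply: le_lt_trans (hm_lipschitz s (g := id) ltr01 _) _.
    move=> x y /(norm1 _ _ _ c1) x1 /(norm1 _ _ _ c1) y1.
    by rewrite mul1r; exact: radial_lip.
  by rewrite expr1n mul1e image_id hm_face_fin.
have F_fin j : hm s (F j) < +oo.
  apply: le_lt_trans (outer_measureU2 (hm s) _ _) _.
  by rewrite lte_add_pinfty// radial_face_fin// ?normrN normr1.
have : hm s (\big[setU/set0]_(j < s.+2) F (inord j)) < +oo.
  apply: le_lt_trans (outer_measure_subadditive (hm s) (fun j => F (inord j)) _) _.
  by apply: lte_sum_pinfty => j _; exact: F_fin.
apply: le_lt_trans; apply: hm_mono => x x1.
pose j := [arg max_(j > ord0) (`|x ord0 j|)%R]%O.
have xj i : (`|x ord0 i| <= `|x ord0 j|)%R.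
  by rewrite /j; case: arg_maxP => // k _; apply.
have xj0 : (0 < `|x ord0 j|)%R.
  rewrite lt_neqAle normr_ge0 andbT eq_sym; apply/negP => /eqP xj0.
  suff x0 : x = 0%R by move: x1; rewrite x0 /sphere/= enorm0 => /eqP; rewrite eq_sym oner_eq0.
  apply/rowP => i; rewrite mxE; apply/eqP; rewrite -normr_le0 -xj0; exact: xj.
pose y := (`|x ord0 j|^-1 *: x)%R.
have xy : radial y = x by rewrite /y radialZ ?invr_gt0// radial_sphere.
have yi i : (`|y ord0 i| <= 1)%R.
  by rewrite mxE normrM normfV normr_id mulrC ler_pdivrMr// mul1r.
rewrite -(bigcup_mkord _ (fun j => F (inord j))); exists j; first exact: ltn_ord.
rewrite inord_val.
have [x0|x0] := leP 0%R (x ord0 j).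
  left; exists y => //; split=> //; rewrite mxE ger0_norm// mulVf//.
  by rewrite -normr_gt0.
right; exists y => //; split=> //; rewrite mxE ltr0_norm// invrN mulNr mulVf//.
by rewrite lt_eqF.
Qed.

(** The sphere, flattened along [u] and enlarged by [c = r + 1], covers the piece: the projection of
    a point of norm at most [r], divided by [c], has norm at most 1 and lifts to the sphere. *)
Lemma hm_hyperplane_fin s (u : 'rV[R]_s.+2) (h r : R) : (dotv u u = 1)%R ->
  hm s ([set x | dotv u x = h] `&` [set x | (enorm x <= r)%R]) < +oo.
Proof.
move=> u1.
have [r0|r0] := ltP r 0%R.
  rewrite (_ : _ `&` _ = set0) ?hm_set0 ?ltry// -subset0 => x [_ /=].
  by rewrite leNgt => /negP; apply; rewrite (lt_le_trans r0)// enorm_ge0.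
pose c := (r + 1)%R; have c0 : (0 < c)%R by rewrite /c; lra.
pose f x := (h *: u + c *: stretch u 0 x)%R.
have : hm s (f @` (@sphere R s.+2)) < +oo.
  apply: le_lt_trans (hm_lipschitz s (g := id) c0 _) _.
    move=> x y _ _; rewrite /f opprD addrACA subrr add0r -scalerBr enormZ gtr0_norm//.
    by rewrite ler_pM2l// proj_lip.
  rewrite image_id lte_mul_pinfty// ?lee_fin ?exprn_ge0 ?ltW//.
  exact: hm_sphere_fin.
apply: le_lt_trans; apply: hm_mono => x [/= ux xr].
pose z := (c^-1 *: stretch u 0 x)%R.
have zu : dotv z u = 0%R by rewrite /z dotvZl dotv_proj// mulr0.
have z1 : (dotv z z <= 1)%R.
  rewrite -sqr_enorm /z enormZ normfV gtr0_norm// mulrC -[leRHS](expr1n R 2).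
  rewrite lerXn2r ?nnegrE ?divr_ge0 ?enorm_ge0// ?(ltW c0)// ler_pdivrMr// mul1r.
  rewrite -[stretch _ _ _]subr0 -[X in (_ - X)%R](_ : stretch u 0 0 = 0%R); last first.
    by rewrite /stretch dotv0l mulr0 scale0r addr0.
  by rewrite (le_trans (proj_lip u1 _ _))// subr0 (le_trans xr)// /c lerDl.
exists (glift u z); first exact: glift_sphere.
rewrite /f proj_glift// /z scalerA mulfV ?gt_eqF// scale1r addrC -ux dotvC.
by rewrite -stretch_decomp.
Qed.

End Finite.

(** Converts a slack in measure into a slack in length, since a Lipschitz constant enters the
    measure to the power [s.+1]. *)
Lemma exists_root_gt1 (R : realType) (L : R) k : 1 < L ->
  exists2 L1, 1 < L1 & L1 ^+ k.+1 = L.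
Proof.
move=> L1; pose r := L `^ (k.+1%:R^-1).
have L0 : 0 <= L by rewrite ltW// (lt_trans _ L1).
have rk : r ^+ k.+1 = L.
  by rewrite /r -powR_mulrn ?powR_ge0// -powRrM mulVf// powRr1.
exists r => //; rewrite ltNge; apply/negP => r1.
have : r ^+ k.+1 <= 1 by rewrite exprn_ile1 ?powR_ge0.
by rewrite rk leNgt L1.
Qed.

(** * Contraction by the two projections, and the size of caps *)

Section Pieces.
Variables (R : realType) (s : nat).
Local Notation V := 'rV[R]_s.+2.
Implicit Types (u x y z e : V) (A B : set V).

Variable s0 : R.
Hypothesis s0_gt0 : 0 < s0.
Hypothesis s0_lt1 : s0 < 1.
Let l := Num.sqrt (1 - s0 ^+ 2).

Let s02 : s0 ^+ 2 < 1. Proof. by rewrite expr_lt1// ltW. Qed.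
Let l_gt0 : 0 < l. Proof. by rewrite sqrtr_gt0 subr_gt0. Qed.
Let sqr_l : l ^+ 2 = 1 - s0 ^+ 2. Proof. by rewrite sqr_sqrtr// subr_ge0 ltW. Qed.

Lemma ler_enorm (c : R) x y : 0 <= c ->
  (enorm x <= c * enorm y) = (dotv x x <= c ^+ 2 * dotv y y).
Proof.
move=> c0; rewrite -!sqr_enorm -exprMn ler_sqr// nnegrE ?enorm_ge0//.
by rewrite mulr_ge0// enorm_ge0.
Qed.

Lemma unit_direction u v : dotv u u = 1 -> dotv v u = 0 -> 0 < enorm v ->
  let e := (enorm v)^-1 *: v in
  [/\ dotv e e = 1, dotv u e = 0 & v = enorm v *: e].
Proof.
move=> u1 vu v0 /=; split.
- by rewrite dotvZl dotvZr mulrA -sqr_enorm; field; rewrite gt_eqF.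
- by rewrite dotvZr dotvC vu mulr0.
- by rewrite scalerA mulfV ?gt_eqF// scale1r.
Qed.

(** By [sqr_radialB] the squared distance drops by at least the square of the difference of norms.
    Near [p] that difference is about [dotv w v = g * dotv w e], where [v] is the direction of [p]
    and [g >= s0] the length of its part along the hyperplane. Up to the factor [L1], distances are
    thus dominated by those after [stretch e l], whose effect on the measure is known. *)
Lemma radial_contract u h B : dotv u u = 1 -> borel B ->
  B `<=` [set x | dotv u x = h] ->
  (forall x, B x -> 1 <= enorm x /\ s0 * enorm x <= enorm (stretch u 0 x)) ->
  (hm s (@radial R s.+2 @` B) <= l%:E * hm s B)%E.
Proof.
move=> u1 bB BH far; apply: hm_image_local => // L p /exists_root_gt1 H Bp.
have [L1 L1_gt1 L1E] := H s.
have [p1 pfar] := far p Bp.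
have p0 : 0 < enorm p by rewrite (lt_le_trans ltr01).
pose v := radial p; pose v' := stretch u 0 v; pose g := enorm v'.
have v1 : enorm v = 1 by rewrite enorm_radial// -enorm_eq0 gt_eqF.
have gs0 : s0 <= g.
  by rewrite /g /v' /v stretchZ enormZ ger0_norm ?invr_ge0 ?enorm_ge0// mulrC ler_pdivlMr.
have g0 : 0 < g by rewrite (lt_le_trans s0_gt0).
have [e1 ue v'E] := unit_direction u1 (dotv_proj u1 v) g0.
set e := _ *: _ in e1 ue v'E; rewrite -/g in v'E.
(* The linearization error is at most [4 * d] times the squared distance. The factor [L1 ^+ 2]
   leaves room for [l ^+ 2 * (L1 ^+ 2 - 1)] times it, because [stretch e l] shrinks lengths by no
   more than [l]. *)
pose d := l ^+ 2 * (L1 ^+ 2 - 1) / 4.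
have L12 : 1 < L1 ^+ 2 by rewrite expr_gt1// ltW// (lt_trans _ L1_gt1).
have d0 : 0 < d by rewrite divr_gt0// mulr_gt0 ?exprn_gt0// subr_gt0.
exists [set x | enorm (x - p) < d]; first exact: open_enorm_ball.
split; first by rewrite /= subrr enorm0.
move=> C bC CB.
have CH : C `<=` [set x | dotv u x = h] by move=> x /CB[/BH].
rewrite -L1E EFinM -muleA -(hm_stretch e1 ue _ l_gt0 bC CH); last first.
  by move=> r; exact: hm_hyperplane_fin.
apply: hm_lipschitz; first by rewrite (lt_trans _ L1_gt1).
move=> x y Cx Cy; have [Bx /= xp] := CB x Cx; have [By /= yp] := CB y Cy.
have [x1 _] := far x Bx; have [y1 _] := far y By.
rewrite ler_enorm ?(ltW (lt_trans _ L1_gt1))// -stretchB sqr_stretch// sqr_l.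
apply: le_trans (sqr_radialB x1 y1) _.
set w := x - y; pose c := enorm x + enorm y.
have c2 : 2 <= c by rewrite /c; lra.
have wc : (enorm x - enorm y) * c = dotv w (x + y).
  transitivity (enorm x ^+ 2 - enorm y ^+ 2); first by rewrite /c; ring.
  by rewrite !sqr_enorm /w !dotvE (dotvC y x); ring.
(* Replacing [x + y] by [c *: v] in [wc] turns the difference of norms into [dotv w v]; [r] is the
   error made, small because [x] and [y] are close to [p]. *)
pose r := (x + y) - c *: v.
have rd : enorm r <= 4 * d.
  have -> : r = ((x - p) + (y - p)) + ((enorm p - enorm x) + (enorm p - enorm y)) *: v.
    have pv : p = enorm p *: v by rewrite /v /radial scalerA mulfV ?gt_eqF// scale1r.
    rewrite {1 2}pv /r /c !scalerDl !scaleNr.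
    by apply/rowP => i; rewrite !mxE; ring.
  apply: le_trans (enormD _ _) _; rewrite enormZ v1 mulr1.
  have := enormD (x - p) (y - p).
  have := ler_normD (enorm p - enorm x) (enorm p - enorm y).
  have := enormB_ge p x; have := enormB_ge p y; rewrite !(enormBC p).
  by move=> *; lra.
have wv : dotv w v = g * dotv w e.
  have wu : dotv w u = 0.
    by rewrite /w !dotvE (dotvC x) (dotvC y) (CH x Cx) (CH y Cy) subrr.
  by rewrite (stretch_decomp u v) dotvDr dotvZr wu mulr0 addr0 v'E dotvZr.
pose b := enorm x - enorm y - dotv w v.
have bw : `|b| <= 2 * d * enorm w.
  have bc : b * c = dotv w r.
    by rewrite /b mulrBl wc /r !dotvDr dotvNr dotvZr; ring.
  have c0 : 0 < c by rewrite (lt_le_trans _ c2).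
  have : `|b * c| <= enorm w * (4 * d).
    by rewrite bc (le_trans (cauchy_schwarz _ _))// ler_wpM2l// enorm_ge0.
  rewrite normrM (gtr0_norm c0) => bcw.
  have := ler_wpM2l (normr_ge0 b) c2; lra.
have we : dotv w e ^+ 2 <= dotv w w.
  by rewrite (le_trans (cauchy_schwarz_sqr _ _))// e1 mulr1.
have wvw : `|dotv w v| <= enorm w.
  by rewrite (le_trans (cauchy_schwarz _ _))// v1 mulr1.
have key : g ^+ 2 * dotv w e ^+ 2 - 4 * d * dotv w w <= (enorm x - enorm y) ^+ 2.
  have -> : enorm x - enorm y = dotv w v + b by rewrite /b; ring.
  rewrite -exprMn -wv sqrrD -sqr_enorm.
  have : `|dotv w v * b| <= enorm w * (2 * d * enorm w).
    by rewrite normrM ler_pM.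
  rewrite ler_norml => /andP[h1 _]; have := sqr_ge0 b.
  rewrite -(mulr_natl (_ * _)); lra.
have gs : s0 ^+ 2 * dotv w e ^+ 2 <= g ^+ 2 * dotv w e ^+ 2.
  by rewrite ler_wpM2r ?sqr_ge0// lerXn2r// nnegrE ltW.
have ww : (1 - s0 ^+ 2) * dotv w w <= dotv w w - s0 ^+ 2 * dotv w e ^+ 2.
  by have := ler_wpM2l (sqr_ge0 s0) we; lra.
have d4 : 4 * d = (1 - s0 ^+ 2) * (L1 ^+ 2 - 1) by rewrite /d sqr_l; field.
have L10 : 0 <= L1 ^+ 2 - 1 by rewrite subr_ge0 ltW.
have := ler_wpM2l L10 ww; rewrite d4 in key; lra.
Qed.

(** Here the source is curved and the image flat, so the linear map is applied to the image: it
    suffices that [stretch e l^-1] after the projection is still Lipschitz with constant [L1] near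
    [p]. A chord [D] of the sphere is nearly orthogonal to [p], so its lost normal part [T]
    satisfies [T * t] close to [- g * dotv w e]; the loss [T ^+ 2] pays for the stretching. *)
Lemma proj_contract u B : dotv u u = 1 -> borel B -> B `<=` @sphere R s.+2 ->
  (forall x, B x -> 0 < dotv x u /\ s0 <= enorm (stretch u 0 x)) ->
  (hm s (stretch u 0 @` B) <= l%:E * hm s B)%E.
Proof.
move=> u1 bB BS far; apply: hm_image_local => // L p /exists_root_gt1 H Bp.
have [L1 L1_gt1 L1E] := H s.
have [t0 pfar] := far p Bp; set t := dotv p u in t0.
pose v := stretch u 0 p; pose g := enorm v.
have g0 : 0 < g by rewrite (lt_le_trans s0_gt0).
have [e1 ue vE] := unit_direction u1 (dotv_proj u1 p) g0.
set e := _ *: _ in e1 ue vE; rewrite -/v -/g in vE.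
have gt1 : g ^+ 2 + t ^+ 2 = 1.
  have /sphere_dotv p1 := BS p Bp.
  by rewrite /g sqr_enorm /v sqr_proj// p1 /t; ring.
have g1 : g <= 1.
  rewrite -[leRHS](sqrtr1) -(ger0_norm (ltW g0)) -sqrtr_sqr ler_wsqrtr//.
  by have := sqr_ge0 t; lra.
pose d := t ^+ 2 * (L1 ^+ 2 - 1) / 2.
have L12 : 1 < L1 ^+ 2 by rewrite expr_gt1// ltW// (lt_trans _ L1_gt1).
have d0 : 0 < d by rewrite divr_gt0// mulr_gt0 ?exprn_gt0// subr_gt0.
exists [set x | enorm (x - p) < d]; first exact: open_enorm_ball.
split; first by rewrite /= subrr enorm0.
move=> A bA AB; pose C := stretch u 0 @` A.
have CH : C `<=` [set x | dotv u x = 0] by move=> _ [x Ax <-]; rewrite /= dotvC dotv_proj.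
(* On the open half sphere the projection has the continuous inverse [glift u], so the image is a
   Borel preimage within the hyperplane. *)
have bC : borel C.
  have -> : C = [set x | dotv u x = 0] `&` glift u @^-1` A.
    apply/seteqP; split => [z Cz|z [/= uz Az]].
      split; first exact: CH.
      case: Cz => x Ax <-; have [/far[x0 _] _] := AB x Ax.
      have [/BS Sx _] := AB x Ax.
      by rewrite /preimage/= glift_proj// ltW.
    by exists (glift u z) => //; rewrite proj_glift// dotvC.
  apply: borelI; first exact: borel_fun_eq.
  by apply: borel_preimage => //; exact: continuous_glift.
have li0 : 0 < l^-1 by rewrite invr_gt0.
have -> : hm s C = (l%:E * hm s (stretch e l^-1 @` C))%E.
  rewrite (hm_stretch e1 ue _ li0 bC CH); last first.
    by move=> r; exact: hm_hyperplane_fin.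
  by rewrite muleA -EFinM mulfV ?mul1e// gt_eqF.
rewrite mulrC EFinM -muleA lee_pmul2l ?lte_fin// -L1E.
rewrite /C image_comp -[in leRHS](image_id A).
apply: hm_lipschitz; first by rewrite (lt_trans _ L1_gt1).
move=> x y Ax Ay; have [Bx /= xp] := AB x Ax; have [By /= yp] := AB y Ay.
have /sphere_dotv x1 := BS x Bx; have /sphere_dotv y1 := BS y By.
rewrite ler_enorm ?(ltW (lt_trans _ L1_gt1))// -!stretchB sqr_stretch//.
set w := stretch u 0 (x - y); set D := x - y in w *; pose T := dotv D u.
have DE : dotv D D = dotv w w + T ^+ 2 by rewrite /w sqr_proj// subrK.
pose eps := dotv D p.
have epsE : eps = g * dotv w e + T * t.
  rewrite /eps {1}(stretch_decomp u D) -/w -/T dotvDl dotvZl (dotvC u) -/t.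
  congr (_ + _); rewrite (stretch_decomp u p) -/v dotvDr dotvZr.
  by rewrite dotv_proj// mulr0 addr0 vE dotvZr.
(* Two points of equal norm have difference orthogonal to their sum, so only the deviations of [x]
   and [y] from [p] contribute. *)
have eps_le : `|eps| <= d * enorm D.
  have -> : eps = - 2^-1 * dotv D ((x - p) + (y - p)).
    have : dotv D (x + y) = 0 by rewrite /D !dotvE x1 y1 (dotvC y x); ring.
    rewrite /eps !dotvDr !dotvNr => h; lra.
  have n2 : `|- 2^-1 : R| = 2^-1 by rewrite normrN ger0_norm.
  rewrite normrM n2.
  have := cauchy_schwarz D (x - p + (y - p)); have := enormD (x - p) (y - p).
  move=> h1 h2.
  have h3 : enorm D * enorm (x - p + (y - p)) <= enorm D * (2 * d).
    by rewrite ler_wpM2l ?enorm_ge0//; lra.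
  lra.
have we : `|dotv w e| <= enorm D.
  rewrite (le_trans (cauchy_schwarz _ _))// (enorm_unit e1) mulr1.
  by rewrite -ler_sqr ?nnegrE ?enorm_ge0// !sqr_enorm DE lerDl sqr_ge0.
have key : g ^+ 2 * dotv w e ^+ 2 - 2 * d * dotv D D <= t ^+ 2 * T ^+ 2.
  rewrite -[X in _ <= X]exprMn (mulrC t) (_ : T * t = eps - g * dotv w e); last first.
    by rewrite epsE; ring.
  rewrite sqrrB exprMn -sqr_enorm.
  have : `|eps * (g * dotv w e)| <= (d * enorm D) * (1 * enorm D).
    by rewrite !normrM ler_pM ?mulr_ge0// ler_pM// ger0_norm// ltW.
  rewrite mul1r ler_norml => /andP[_ h1]; have := sqr_ge0 eps.
  rewrite -(mulr_natl (_ * _)); lra.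
have t2 : 0 < t ^+ 2 by rewrite exprn_gt0.
have d2 : 2 * d = t ^+ 2 * (L1 ^+ 2 - 1) by rewrite /d; field.
have gs : s0 ^+ 2 <= g ^+ 2 by rewrite lerXn2r// nnegrE ltW.
have l2 : 0 < 1 - s0 ^+ 2 by rewrite subr_gt0.
rewrite exprVn sqr_l.
have kE : 1 - (1 - s0 ^+ 2)^-1 = - (s0 ^+ 2 / (1 - s0 ^+ 2)) by field; rewrite gt_eqF.
rewrite kE mulNr opprK.
(* The two quotients are squared tangents of the angles with sines [s0] and [g]. *)
have k1 : s0 ^+ 2 / (1 - s0 ^+ 2) * dotv w e ^+ 2 <= g ^+ 2 / t ^+ 2 * dotv w e ^+ 2.
  rewrite ler_wpM2r ?sqr_ge0// ler_pdivrMr// mulrAC ler_pdivlMr//.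
  have := sqr_ge0 s0; have -> : t ^+ 2 = 1 - g ^+ 2 by lra.
  nra.
have k2 : g ^+ 2 / t ^+ 2 * dotv w e ^+ 2 <= T ^+ 2 + (L1 ^+ 2 - 1) * dotv D D.
  rewrite mulrAC ler_pdivrMr//; rewrite d2 in key; lra.
by rewrite /D in DE *; lra.
Qed.

Definition cap u : set V :=
  [set x | sphere x /\ 0 <= dotv x u /\ enorm (stretch u 0 x) <= s0].

(** The cap is covered by the image of the sphere under flattening, scaling by [s0] and lifting
    back. Over the disc of radius [s0] the height has slope at most [s0 / l], so lifting costs the
    factor [sqrt (1 + s0^2 / l^2) = 1 / l], and the Lipschitz constant is [s0 / l]. *)
Lemma hm_cap u : dotv u u = 1 ->
  (hm s (cap u) <= ((s0 / l) ^+ s.+1)%:E * hm s (@sphere R s.+2))%E.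
Proof.
move=> u1; pose f x := glift u (s0 *: stretch u 0 x).
have fu x : dotv (s0 *: stretch u 0 x) u = 0 by rewrite dotvZl dotv_proj// mulr0.
have capf : cap u `<=` f @` @sphere R s.+2.
  move=> x [Sx [xu xs0]]; pose z := s0^-1 *: stretch u 0 x.
  have zu : dotv z u = 0 by rewrite dotvZl dotv_proj// mulr0.
  exists (glift u z).
    apply: glift_sphere => //; rewrite -sqr_enorm exprn_ile1 ?enorm_ge0//.
    by rewrite enormZ normfV gtr0_norm// mulrC ler_pdivrMr// mul1r.
  by rewrite /f proj_glift// scalerA mulfV ?gt_eqF// scale1r glift_proj.
apply: le_trans (hm_mono s capf) _.
rewrite -[X in (_ <= _ * hm s X)%E]image_id.
apply: hm_lipschitz; first by rewrite divr_gt0.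
have sl0 : 0 <= s0 / l by rewrite ltW// divr_gt0.
move=> x y /sphere_dotv x1 /sphere_dotv y1; rewrite ler_enorm//.
set zx := stretch u 0 x; set zy := stretch u 0 y.
apply: (@le_trans _ _ ((s0 / l) ^+ 2 * dotv (zx - zy) (zx - zy))); last first.
  rewrite ler_wpM2l ?sqr_ge0// -stretchB sqr_proj// gerBl sqr_ge0//.
have zle v : dotv v v = 1 -> dotv (stretch u 0 v) (stretch u 0 v) <= 1.
  by move=> v1; rewrite sqr_proj// v1 gerBl sqr_ge0.
have zx1 : dotv zx zx <= 1 by exact: zle.
have zy1 : dotv zy zy <= 1 by exact: zle.
pose al := Num.sqrt (1 - dotv (s0 *: zx) (s0 *: zx)).
pose be := Num.sqrt (1 - dotv (s0 *: zy) (s0 *: zy)).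
have -> : f x - f y = s0 *: (zx - zy) + (al - be) *: u.
  rewrite /f /glift -/zx -/zy -/al -/be scalerBr scalerBl opprD.
  by rewrite !addrA; congr (_ - _); rewrite addrAC.
have Du : dotv (zx - zy) u = 0.
  by rewrite dotvDl dotvNl /zx /zy !dotv_proj// subrr.
set D := zx - zy in Du *.
have -> : dotv (s0 *: D + (al - be) *: u) (s0 *: D + (al - be) *: u) =
    s0 ^+ 2 * dotv D D + (al - be) ^+ 2.
  have pyth (v : V) c : dotv v u = 0 -> dotv (s0 *: v + c *: u) (s0 *: v + c *: u) =
      s0 ^+ 2 * dotv v v + c ^+ 2.
    by move=> vu; rewrite !dotvE (dotvC u) vu u1; ring.
  exact: pyth.
have sqr_al : al ^+ 2 = 1 - s0 ^+ 2 * dotv zx zx.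
  rewrite sqr_sqrtr; first by rewrite dotvZl dotvZr; ring.
  by rewrite subr_ge0 dotvZl dotvZr mulrA -expr2 mulr_ile1 ?sqr_ge0 ?dotv_ge0// ltW.
have sqr_be : be ^+ 2 = 1 - s0 ^+ 2 * dotv zy zy.
  rewrite sqr_sqrtr; first by rewrite dotvZl dotvZr; ring.
  by rewrite subr_ge0 dotvZl dotvZr mulrA -expr2 mulr_ile1 ?sqr_ge0 ?dotv_ge0// ltW.
have s00 := sqr_ge0 s0.
have l_al : l <= al.
  by rewrite ler_wsqrtr// lerB// dotvZl dotvZr mulrA -expr2 ler_piMr.
have l_be : l <= be.
  by rewrite ler_wsqrtr// lerB// dotvZl dotvZr mulrA -expr2 ler_piMr.
have ab : (al - be) * (al + be) = - (s0 ^+ 2 * dotv D (zx + zy)).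
  have -> : (al - be) * (al + be) = al ^+ 2 - be ^+ 2 by ring.
  have pol (v w : V) : dotv (v - w) (v + w) = dotv v v - dotv w w.
    by rewrite !dotvE (dotvC w v); ring.
  by rewrite sqr_al sqr_be /D pol; ring.
have ZD : `|dotv D (zx + zy)| <= 2 * enorm D.
  rewrite (le_trans (cauchy_schwarz _ _))// mulrC ler_wpM2r ?enorm_ge0//.
  rewrite (le_trans (enormD _ _))//.
  have e1 (z : V) : dotv z z <= 1 -> enorm z <= 1.
    by move=> z1; rewrite -[leRHS]sqrtr1 ler_wsqrtr.
  have := e1 _ zx1; have := e1 _ zy1; lra.
have abl : `|al - be| * (2 * l) <= s0 ^+ 2 * (2 * enorm D).
  apply: (@le_trans _ _ (`|al - be| * (al + be))).
    by rewrite ler_wpM2l//; lra.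
  rewrite -[X in _ * X]ger0_norm; last by move: (ltW l_gt0); lra.
  by rewrite -normrM ab normrN normrM ger0_norm// ler_wpM2l.
have abD : `|al - be| <= s0 ^+ 2 / l * enorm D.
  by rewrite mulrAC ler_pdivlMr//; lra.
have abD2 : (al - be) ^+ 2 <= (s0 ^+ 2 / l) ^+ 2 * dotv D D.
  rewrite -sqr_enorm -exprMn -real_normK ?num_real//.
  by rewrite lerXn2r// nnegrE mulr_ge0 ?enorm_ge0// divr_ge0// ltW.
apply: le_trans (lerD (lexx _) abD2) _; rewrite -mulrDl ler_wpM2r ?dotv_ge0//.
rewrite !expr_div_n sqr_l le_eqVlt; apply/orP; left; apply/eqP.
by field; rewrite subr_eq0 eq_sym lt_eqF.
Qed.

Lemma hm_set1 (x : V) : hm s [set x] = 0%E.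
Proof.
apply/eqP; rewrite eq_le hm_ge0 andbT; apply: hm_le => d d0.
have x0 : ediam [set x] = 0%E.
  apply/eqP; rewrite eq_le ediam_ge0 andbT.
  by apply: ediam_le => // _ _ -> ->; rewrite subrr enorm0.
apply: (le_trans (@hd_diam _ _ s d [set x] _)); first by rewrite x0 lee_fin ltW.
by rewrite x0/= expr0n.
Qed.

End Pieces.

(* The radial projection fixes the slice but contracts its measure strictly. *)
Lemma hm_sphere_slice (R : realType) s (u : 'rV[R]_s.+2) h : dotv u u = 1 ->
  hm s (@sphere R s.+2 `&` [set x | dotv u x = h]) = 0%E.
Proof.
move=> u1; set A := _ `&` _.
have slice x : A x -> dotv (stretch u 0 x) (stretch u 0 x) = 1 - h ^+ 2.
  by move=> [/sphere_dotv x1 /= ux]; rewrite sqr_proj// x1 (dotvC x) ux.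
have [h1|h1] := leP 1 (h ^+ 2).
  apply/eqP; rewrite eq_le hm_ge0 andbT -(hm_set1 (h *: u)); apply: hm_mono => x Ax.
  have /eqP : stretch u 0 x = 0.
    apply/eqP; rewrite -dotv_eq0 eq_le dotv_ge0 andbT slice//; lra.
  rewrite /stretch sub0r mulN1r scaleNr subr_eq0 => /eqP ->.
  by case: Ax => _ /= <-; rewrite dotvC.
(* Half the sine common to all points of the slice: still a lower bound for it, and below 1 even
   when [h = 0]. *)
pose s0 := Num.sqrt (1 - h ^+ 2) / 2.
have q0 : 0 < Num.sqrt (1 - h ^+ 2) by rewrite sqrtr_gt0 subr_gt0.
have q1 : Num.sqrt (1 - h ^+ 2) <= 1.
  by rewrite -[leRHS]sqrtr1 ler_wsqrtr// gerBl sqr_ge0.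
have s0_gt0 : 0 < s0 by rewrite divr_gt0.
have s0_lt1 : s0 < 1 by rewrite /s0; lra.
have bA : borel A.
  apply: borelI; last exact: borel_fun_eq.
  by apply: borel_fun_eq => //; exact: continuous_enorm_id.
have := @radial_contract R s s0 s0_gt0 s0_lt1 u h A u1 bA.
have -> : @radial R s.+2 @` A = A.
  apply/seteqP; split => [_ [x Ax <-]|x Ax].
    by rewrite radial_sphere//; case: Ax.
  by exists x => //; rewrite radial_sphere//; case: Ax.
have fA : hm s A \is a fin_num.
  rewrite ge0_fin_numE ?hm_ge0// (le_lt_trans _ (hm_sphere_fin R s))//.
  by apply: hm_mono => x [].
set l := Num.sqrt (1 - s0 ^+ 2) => H.
have {}H : (hm s A <= l%:E * hm s A)%E.
  apply: H => [x [_]//|x Ax]; have x1 : enorm x = 1 by case: Ax.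
  rewrite x1 lexx mulr1; split=> //.
  by rewrite /enorm slice// /s0; lra.
have l1 : l < 1.
  by rewrite -[ltRHS]sqrtr1 ltr_sqrt// gtrBl exprn_gt0.
move: H; rewrite -(fineK fA) -EFinM lee_fin => H.
have := fine_ge0 (hm_ge0 s A); set a := fine _ in H *; move=> a0.
by congr EFin; nra.
Qed.

Section CountableUnions.
Variables (R : realType) (n s : nat).
Local Notation V := 'rV[R]_n.

Lemma hmU2 (A B : set V) : (hm s (A `|` B) <= hm s A + hm s B)%E.
Proof. exact: (outer_measureU2 (hm s)). Qed.

Lemma borel_bigcup_countType (I : countType) (F : I -> set V) :
  (forall i, borel (F i)) -> borel (\bigcup_i F i).
Proof.
by move=> bF; apply: (@countable_bigcupT_measurable _ (borelType R n)).
Qed.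

Lemma hm_image_glue_countType (I : countType) (f : V -> V) (l : R) (A : set V)
    (U : I -> set V) : 0 <= l -> borel A -> (forall i, borel (U i)) ->
  A `<=` \bigcup_i U i ->
  (forall i B, borel B -> B `<=` A `&` U i -> (hm s (f @` B) <= l%:E * hm s B)%E) ->
  (hm s (f @` A) <= l%:E * hm s A)%E.
Proof.
move=> l0 bA bU AU H.
apply: (@hm_image_glue _ _ _ _ _ _ (fun k => oapp U set0 (unpickle k))) => //.
- by move=> k; case: unpickle => //=; exact: borel0.
- by move=> x /AU[i _ Uix]; exists (pickle i) => //; rewrite pickleK.
- move=> k B bB; case: unpickle => [i|] /=; first exact: H.
  by rewrite setI0 subset0 => ->; rewrite image_set0 hm_set0 mule0.
Qed.

Lemma hm_bigcup_ord m (C : 'I_m -> set V) :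
  (hm s (\bigcup_i C i) <= \sum_(i < m) hm s (C i))%E.
Proof.
pose F k := oapp C set0 (insub k).
apply: (@le_trans _ _ (\sum_(i < m) hm s (F i))%E); last first.
  by apply: lee_sum => i _; rewrite /F valK.
apply: le_trans (outer_measure_subadditive (hm s) F m); apply: hm_mono.
move=> x [i _ Cx]; rewrite -(bigcup_mkord _ F); exists i; first exact: ltn_ord.
by rewrite /F valK.
Qed.

End CountableUnions.

(** * Facets of a polytope *)

Section Polytope.
Variables (R : realType) (s m : nat).
Local Notation V := 'rV[R]_s.+2.
Variables (a : 'I_m -> V) (b : 'I_m -> R).
Let P : set V := [set x | forall i, dotv (a i) x <= b i].
Hypothesis Pbounded : exists r : R, forall x, P x -> enorm x <= r.
Variable s0 : R.
Hypothesis s0_gt0 : 0 < s0.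
Hypothesis s0_lt1 : s0 < 1.
Let l := Num.sqrt (1 - s0 ^+ 2).
Implicit Types (x y : V) (i j k : 'I_m).

Let S : set V := @sphere R s.+2.
Let u k : V := radial (a k).
Let h k : R := b k / enorm (a k).

Let u1 k : a k != 0 -> dotv (u k) (u k) = 1.
Proof. by move=> ak; rewrite -sqr_enorm enorm_radial// expr1n. Qed.

Let dotv_u k x : dotv (u k) x = dotv (a k) x / enorm (a k).
Proof. by rewrite /u /radial dotvZl mulrC. Qed.

Let ea k : a k != 0 -> 0 < enorm (a k).
Proof. by move=> ak; rewrite lt_def enorm_ge0 enorm_eq0 ak. Qed.

Let borelS : borel S.
Proof. by apply: borel_fun_eq => //; exact: continuous_enorm_id. Qed.

Let closedP : closed P.
Proof.
rewrite (_ : P = \bigcap_i [set x | dotv (a i) x <= b i]); last first.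
  by apply/seteqP; split => [x Px i _|x Px i]; exact: Px.
apply: closed_bigI => i _.
rewrite (_ : mkset _ = dotv (a i) @^-1` [set t | t <= b i])//.
apply: closed_comp; last exact: closed_le.
by move=> x _; exact: continuous_dotvr.
Qed.

Definition facet k := [set x | P x /\ a k != 0 /\ dotv (a k) x = b k].
Definition inner_facet k := [set x | facet k x /\ enorm x < 1].
(** With [0 < b k] the origin lies strictly on the inner side, so a point of the facet makes an
    acute angle with the normal, as [cone_near] requires. Facets through which rays from the origin
    leave [P] beyond the sphere are of this kind. *)
Definition outer_facet k := [set x | facet k x /\ 1 < enorm x /\ 0 < b k].

Let continuous_norm : continuous (fun x : V => enorm x).
Proof. exact: continuous_enorm_id. Qed.

Let borel_facet k : borel (facet k).
Proof.
have [ak|ak] := boolP (a k == 0).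
  rewrite (_ : facet k = set0); first exact: borel0.
  by rewrite -subset0 => x [_ []]; rewrite ak.
rewrite (_ : facet k = P `&` [set x | dotv (a k) x = b k]).
  by apply: borelI; [exact: borel_closed|exact: borel_fun_eq].
by apply/seteqP; split => [x [? []]|x []].
Qed.

Let borel_inner k : borel (inner_facet k).
Proof. by apply: borelI => //; apply: borel_fun_lt. Qed.

Let borel_outer k : borel (outer_facet k).
Proof.
rewrite (_ : outer_facet k = facet k `&` [set x | 1 < enorm x] `&` [set x : V | 0 < b k]).
  by do ![apply: borelI => //]; apply: borel_fun_lt.
by apply/seteqP; split => [x [? []]|x [[]]].
Qed.

(** A cone rather than a cap, so that a point of a facet and its radial image can be tested alike;
    on the sphere it is the cap of sine [s0] around the normal. *)
Definition cone_near k :=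
  [set x | a k != 0 /\ 0 <= dotv x (u k) /\ enorm (stretch (u k) 0 x) <= s0 * enorm x].
Definition near_set := \bigcup_k cone_near k.

Let borel_near : borel near_set.
Proof.
apply: borel_bigcup_countType => k.
have [ak|ak] := boolP (a k == 0).
  rewrite (_ : cone_near k = set0); first exact: borel0.
  by rewrite -subset0 => x []; rewrite ak.
rewrite (_ : cone_near k = [set x | 0 <= dotv x (u k)] `&`
   [set x | enorm (stretch (u k) 0 x) <= s0 * enorm x]); last first.
  by apply/seteqP; split => [x [_ []]|x []].
apply: borelI; apply: borel_fun_le => //.
  by apply: continuous_enorm; exact: continuous_stretch.
by apply: continuous_funM.
Qed.

Let near_radial x : x != 0 -> near_set (radial x) <-> near_set x.
Proof.
move=> x0; have ex : 0 < enorm x by rewrite lt_def enorm_ge0 enorm_eq0 x0.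
have H k : cone_near k (radial x) <-> cone_near k x.
  rewrite /cone_near/= enorm_radial// mulr1.
  rewrite -[radial x]/((enorm x)^-1 *: x) stretchZ enormZ.
  rewrite ger0_norm ?invr_ge0 ?enorm_ge0// mulrC ler_pdivrMr//.
  by rewrite dotvZl pmulr_rge0// invr_gt0.
by split => -[k _ /H Hk]; exists k.
Qed.

Lemma hm_near : (hm s (S `&` near_set) <=
  (m%:R * (s0 / l) ^+ s.+1)%:E * hm s S)%E.
Proof.
rewrite setI_bigcupr; apply: le_trans (hm_bigcup_ord _ _) _.
apply: (@le_trans _ _ (\sum_(k < m) (((s0 / l) ^+ s.+1)%:E * hm s S))%E).
  apply: lee_sum => k _.
  have [ak|ak] := boolP (a k == 0).
    rewrite (_ : _ `&` _ = set0) ?hm_set0 ?mule_ge0 ?hm_ge0//.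
      by rewrite lee_fin exprn_ge0// divr_ge0 ?sqrtr_ge0// ltW.
    by rewrite -subset0 => x [_ []]; rewrite ak.
  apply: le_trans (hm_cap s0_gt0 s0_lt1 (u1 ak)); apply: hm_mono.
  by move=> x [Sx [_ [xu]]]; rewrite (Sx : enorm x = 1) mulr1.
have -> : hm s S = (fine (hm s S))%:E.
  by rewrite fineK// ge0_fin_numE ?hm_ge0// hm_sphere_fin.
by rewrite -!EFinM sumEFin lee_fin sumr_const card_ord -[leLHS]mulr_natl mulrA.
Qed.

Let proj k x : V := stretch (u k) 0 x + h k *: u k.

Let continuous_proj k : continuous (proj k).
Proof. by apply: continuous_funD => //; exact: continuous_stretch. Qed.

(** Besides lying beyond the hyperplane, [x] must lie in the half sphere around [u k], where the
    projection can be inverted; the second condition is the stronger one when [h k] is negative. *)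
Definition lifted k := [set x | S x /\ a k != 0 /\ h k < dotv x (u k) /\
  0 < dotv x (u k) /\ inner_facet k (proj k x)].

Let borel_lifted k : borel (lifted k).
Proof.
have [ak|ak] := boolP (a k == 0).
  rewrite (_ : lifted k = set0); first exact: borel0.
  by rewrite -subset0 => x [_ []]; rewrite ak.
rewrite (_ : lifted k = S `&` [set x | h k < dotv x (u k)] `&`
  [set x | 0 < dotv x (u k)] `&` (proj k @^-1` inner_facet k)).
  apply: borelI; last exact: borel_preimage.
  by do ![apply: borelI => //]; apply: borel_fun_lt.
by apply/seteqP; split => [x [? [_ [? []]]]|x [[[]]]].
Qed.

Let proj_displacement k x : x - proj k x = (dotv x (u k) - h k) *: u k.
Proof.
rewrite {1}(stretch_decomp (u k) x) /proj opprD addrACA subrr add0r.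
by rewrite scalerBl.
Qed.

(* Both projections are the point of [P] nearest to [x]. *)
Let proj_unique i k x : lifted i x -> lifted k x -> proj i x = proj k x.
Proof.
move=> [_ [ai [hi [_ [[Pi [_ bi]] _]]]]] [_ [ak [hk [_ [[Pk [_ bk]] _]]]]].
have nearest j y : a j != 0 -> h j < dotv x (u j) ->
    dotv (a j) (proj j x) = b j -> P y ->
    dotv (x - proj j x) (y - proj j x) <= 0.
  move=> aj hj bj Py; rewrite proj_displacement dotvZl pmulr_rle0 ?subr_gt0//.
  by rewrite dotvDr dotvNr !dotv_u bj -mulrBl pmulr_lle0 ?invr_gt0 ?ea// subr_le0.
have := nearest i _ ai hi bi Pk; have := nearest k _ ak hk bk Pi.
set y := proj i x; set z := proj k x => h1 h2.
apply/eqP; rewrite -subr_eq0 -dotv_eq0 eq_le dotv_ge0 andbT.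
have dots (p q r : V) : dotv (q - r) (q - r) = dotv (p - q) (r - q) + dotv (p - r) (q - r).
  by rewrite !dotvE (dotvC r q); ring.
by rewrite (dots x); lra.
Qed.

(** A single map for all facets: summing over facets would count overlaps of the sets [lifted k]
    repeatedly. By [proj_unique] the chosen index is immaterial. *)
Let unlift x : V :=
  if pselect (exists k, lifted k x) is left e then proj (projT1 (cid e)) x else x.

Let unliftE k x : lifted k x -> unlift x = proj k x.
Proof.
move=> kx; rewrite /unlift; case: pselect => [e|[]]; last by exists k.
by apply: proj_unique => //; exact: (projT2 (cid e)).
Qed.

Let hm_proj k B : hm s (proj k @` B) = hm s (stretch (u k) 0 @` B).
Proof. by rewrite -(hm_translate s (h k *: u k) (stretch _ _ @` _)) image_comp. Qed.

Lemma hm_inner_facets :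
  (hm s (\bigcup_k inner_facet k) <=
   hm s ((S `\` P) `&` near_set) + l%:E * hm s ((S `\` P) `\` near_set))%E.
Proof.
pose A := \bigcup_k lifted k.
have bA : borel A by apply: borel_bigcup_countType.
have AP : A `<=` S `\` P.
  move=> x [k _ [Sx [ak [hk _]]]]; split=> // /(_ k).
  move: hk; rewrite dotvC dotv_u /h ltr_pM2r ?invr_gt0 ?ea// => hk.
  by rewrite leNgt hk.
have l0 : 0 < l by rewrite sqrtr_gt0 subr_gt0 expr_lt1// ltW.
apply: (@le_trans _ _ (hm s (unlift @` (A `&` near_set)) + hm s (unlift @` (A `\` near_set)))%E).
  apply: le_trans (hmU2 _ _ _); apply: hm_mono.
  rewrite -image_setU setUIDK => y [k _ Fy].
  have [[Py [ak bk]] y1] := Fy.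
  pose z := stretch (u k) 0 y; pose x := glift (u k) z.
  have zu : dotv z (u k) = 0 by rewrite dotv_proj ?u1.
  have yu : dotv y (u k) = h k by rewrite dotvC dotv_u bk.
  (* The left side is the squared norm of [y]. Hence the height [sqrt (1 - dotv z z)] of the sphere
     above [z] exceeds [|h k|], and the lifted point is beyond the facet. *)
  have z1 : dotv z z + h k ^+ 2 < 1.
    rewrite sqr_proj ?u1// yu subrK -sqr_enorm expr_lt1// ?enorm_ge0//.
  have xu : dotv x (u k) = Num.sqrt (1 - dotv z z) by rewrite dotv_glift ?u1.
  have Sx : S x.
    by apply: glift_sphere => //; rewrite ?u1//; have := sqr_ge0 (h k); lra.
  have hx : `|h k| < dotv x (u k).
    by rewrite xu -sqrtr_sqr ltr_sqrt; have := sqr_ge0 (h k); lra.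
  have px : proj k x = y.
    by rewrite /proj proj_glift ?u1// /z -yu -stretch_decomp.
  have Lx : lifted k x.
    split=> //; split=> //; split; first by rewrite (le_lt_trans _ hx)// ler_norm.
    by split; [rewrite (le_lt_trans _ hx)|rewrite px].
  by exists x; [exists k|rewrite (unliftE Lx)].
have bl : borel (S `\` P) by apply: borelD => //; exact: borel_closed.
apply: leeD.
  apply: (@le_trans _ _ (1%:E * hm s (A `&` near_set))%E).
    apply: (hm_image_glue_countType (U := lifted)) => //; first exact: borelI.
    move=> k B bB BA.
    have -> : unlift @` B = proj k @` B.
      apply/seteqP; split => [_ [x Bx <-]|_ [x Bx <-]]; exists x => //;
        by have [_ /unliftE] := BA x Bx.
    rewrite hm_proj -[X in (_ <= _ * hm s X)%E]image_id -(expr1n _ s.+1).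
    have [->|/set0P[x0 Bx0]] := eqVneq B set0.
      by rewrite !image_set0 hm_set0 mule0.
    have [_ [_ [ak _]]] := BA _ Bx0.
    apply: hm_lipschitz => // x y _ _; rewrite mul1r; apply: proj_lip; exact: u1.
  by rewrite mul1e; apply: hm_mono; exact: setSI.
apply: (@le_trans _ _ (l%:E * hm s (A `\` near_set))%E); last first.
  by rewrite lee_pmul2l ?lte_fin//; apply: hm_mono; exact: setSD.
apply: (hm_image_glue_countType (U := lifted)) => //; first exact: ltW.
  exact: borelD.
move=> k B bB BA.
have -> : unlift @` B = proj k @` B.
  apply/seteqP; split => [_ [x Bx <-]|_ [x Bx <-]]; exists x => //;
    by have [_ /unliftE] := BA x Bx.
rewrite hm_proj.
have [->|/set0P[x0 Bx0]] := eqVneq B set0.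
  by rewrite !image_set0 hm_set0 mule0.
have [_ [_ [ak _]]] := BA _ Bx0.
apply: proj_contract => //; first exact: u1.
  by move=> x /BA[_ []].
move=> x /BA[[_ Nx] [Sx [_ [_ [xu _]]]]]; split=> //.
rewrite leNgt; apply/negP => xs; apply: Nx; exists k => //; split=> //.
by split; rewrite ?(Sx : enorm x = 1) ?mulr1 ltW.
Qed.

(** Stands for the interior of [P] in terms of constraints; those with zero normal may hold with
    equality. *)
Definition strict_part := [set x | P x /\ forall k, ~ facet k x].

(** Central projection gives H(A2) <= H(F1 near) + l H(F1 far) and also H(A2 far) <= H(F1 far).
    Adding [1 - l] times the second bound expresses the gain through the sphere instead of the
    facets, where it can be combined with [hm_inner_facets]. *)
Lemma hm_outer_facets :
  (hm s (S `&` strict_part) + (1 - l)%:E * hm s ((S `&` strict_part) `\` near_set) <=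
   hm s (\bigcup_k outer_facet k))%E.
Proof.
pose F := \bigcup_k outer_facet k.
have bF : borel F by apply: borel_bigcup_countType.
have l0 : 0 < l by rewrite sqrtr_gt0 subr_gt0 expr_lt1// ltW.
have l1 : l <= 1 by rewrite -[leRHS]sqrtr1 ler_wsqrtr// gerBl sqr_ge0.
have F1 x : F x -> 1 < enorm x by move=> [k _ [_ []]].
have F0 x : F x -> x != 0.
  by move=> /F1; rewrite -enorm_eq0 => /(lt_trans ltr01); rewrite lt_neqAle eq_sym => /andP[].
have cover : S `&` strict_part `<=` @radial R s.+2 @` F.
  move=> x [Sx [Px nF]].
  (* If no constraint grew along [x], all multiples [t *: x] with [t >= 1] would stay in [P],
     against boundedness. *)
  have [k0 k0x] : exists k, 0 < dotv (a k) x.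
    apply: contrapT => H; have [r Pr] := Pbounded.
    have ax k : dotv (a k) x <= 0.
      by rewrite leNgt; apply/negP => akx; apply: H; exists k.
    pose t := `|r| + 1; have t1 : 1 <= t by rewrite lerDr.
    have t0 : 0 <= t by lra.
    have : P (t *: x).
      move=> k; rewrite dotvZr (le_trans _ (Px k))//.
      by rewrite -subr_ge0 -{1}(mul1r (dotv _ _)) -mulrBl mulr_le0//; lra.
    move=> /Pr; rewrite enormZ (Sx : enorm x = 1) mulr1 ger0_norm//.
    by have := ler_norm r; rewrite /t; lra.
  (* The ray through [x] leaves [P] at the smallest ratio with positive denominator; it exceeds 1
     because [x] lies in [P] and on no facet. *)
  pose ratio k := b k / dotv (a k) x.
  pose k := [arg min_(k < k0 | 0 < dotv (a k) x) ratio k]%O.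
  have [akx kmin] : 0 < dotv (a k) x /\ forall j, 0 < dotv (a j) x -> ratio k <= ratio j.
    by rewrite /k; case: arg_minP.
  have ak : a k != 0 by apply/eqP => ak; rewrite ak dotv0l ltxx in akx.
  have kb : dotv (a k) x < b k.
    rewrite lt_neqAle (Px k) andbT; apply/eqP => kb; apply: (nF k); split=> //.
  have r1 : 1 < ratio k by rewrite ltr_pdivlMr// mul1r.
  have r0 : 0 < ratio k by lra.
  exists (ratio k *: x); last by rewrite radialZ// radial_sphere.
  exists k => //; split; last first.
    by rewrite enormZ (Sx : enorm x = 1) mulr1 gtr0_norm// (lt_trans akx kb).
  split; last by split=> //; rewrite dotvZr /ratio divfK// gt_eqF.
  move=> j; rewrite dotvZr; have [ajx|ajx] := ltP 0 (dotv (a j) x).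
    by have := kmin j ajx; rewrite /(ratio j) ler_pdivlMr.
  rewrite (le_trans _ (Px j))// -subr_ge0 -{1}(mul1r (dotv _ _)) -mulrBl mulr_le0//.
  by lra.
have near_part B : borel B -> B `<=` F -> (hm s (@radial R s.+2 @` B) <= hm s B)%E.
  move=> bB BF; rewrite -[leRHS]mul1e -[X in (_ * hm s X)%E]image_id -(expr1n _ s.+1).
  apply: hm_lipschitz => // x y /BF/F1/ltW x1 /BF/F1/ltW y1.
  by rewrite mul1r; exact: radial_lip.
have bFn : borel (F `&` near_set) by exact: borelI.
have bFf : borel (F `\` near_set) by exact: borelD.
have far_part : (hm s (@radial R s.+2 @` (F `\` near_set)) <= l%:E * hm s (F `\` near_set))%E.
  apply: (hm_image_glue_countType (U := outer_facet)) => //; first exact: ltW.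
  move=> k B bB BF.
  have [->|/set0P[x0 Bx0]] := eqVneq B set0.
    by rewrite !image_set0 hm_set0 mule0.
  have [_ [[_ [ak _]] _]] := BF _ Bx0.
  apply: (@radial_contract _ _ _ _ _ (u k) (h k)) => //; first exact: u1.
    by move=> x /BF[_ [[_ [_ bx]] _]]; rewrite /= dotv_u bx.
  move=> x /BF[[Fx Nx] [[_ [_ bx]] [x1 bk]]]; split; first exact: ltW.
  rewrite leNgt; apply/negP => xs; apply: Nx; exists k => //; split=> //.
  split; last exact: ltW.
  by rewrite dotvC dotv_u bx divr_ge0 ?enorm_ge0// ltW.
have far_cover : (S `&` strict_part) `\` near_set `<=` @radial R s.+2 @` (F `\` near_set).
  move=> x [/cover[y Fy <-] Nx]; exists y => //; split=> // Ny; apply: Nx.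
  by apply/near_radial => //; exact: F0.
rewrite (hm_split s F borel_near).
have l10 : (0 <= (1 - l)%:E)%E by rewrite lee_fin subr_ge0.
apply: (@le_trans _ _ (hm s (F `&` near_set) + l%:E * hm s (F `\` near_set) +
    (1 - l)%:E * hm s (F `\` near_set))%E).
  apply: leeD; last first.
    rewrite lee_wpmul2l//; apply: le_trans (hm_mono s far_cover) _.
    by apply: near_part => // x [].
  apply: le_trans (hm_mono s cover) _.
  rewrite -{1}(setUIDK F near_set) image_setU.
  apply: le_trans (hmU2 _ _ _) _; apply: leeD => //.
  by apply: near_part => // x [].
rewrite -addeA leeD2l// -ge0_muleDl ?lee_fin ?subr_ge0 ?(ltW l0)//.
by rewrite -EFinD (_ : l + (1 - l) = 1)%R ?mul1e// addrC subrK.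
Qed.

Let facet_u k x : facet k x -> dotv (u k) x = h k.
Proof. by move=> [_ [_ xb]]; rewrite dotv_u xb. Qed.

Lemma hm_sphere_facets : hm s (S `&` \bigcup_k facet k) = 0%E.
Proof.
apply/eqP; rewrite eq_le hm_ge0 andbT setI_bigcupr.
apply: le_trans (hm_bigcup_ord _ _) _; apply: sume_le0 => k _.
have [ak|ak] := boolP (a k == 0).
  rewrite (_ : _ `&` _ = set0) ?hm_set0// -subset0 => x [_ [_ []]].
  by rewrite ak.
rewrite -(hm_sphere_slice (h k) (u1 ak)); apply: hm_mono => x [Sx /facet_u xu].
by split.
Qed.

Let not_interior_ray (U : set V) x v :
  (exists2 d : R, 0 < d & forall t, 0 < t -> t < d -> ~ U (x + t *: v)) ->
  ~ interior U x.
Proof.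
move=> [d d0 Uout] Ux.
have [r r0 rU] := open_enorm_nbhs (@open_interior _ U) Ux.
pose t := Num.min (d / 2) (r / (2 * (enorm v + 1))).
have v0 := enorm_ge0 v.
have t0 : 0 < t by rewrite lt_min !divr_gt0//; lra.
have td : t < d by rewrite (@le_lt_trans _ _ (d / 2)) ?ge_min ?lexx//; lra.
apply: (Uout t t0 td); apply: interior_subset; apply: rU.
rewrite addrC addKr enormZ gtr0_norm//.
have tr : t * (2 * (enorm v + 1)) <= r.
  by rewrite -ler_pdivlMr ?ge_min ?lexx ?orbT//; lra.
nra.
Qed.

(** For a lower bound on the deviation one inclusion suffices here, and the opposite one in
    [bd_inter]. *)
Lemma bd_union : (S `\` P) `|` \bigcup_k outer_facet k `<=` bd (@eball R s.+2 `|` P).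
Proof.
move=> x [[Sx Px]|[k _ [[Px [ak bk]] [x1 _]]]]; split.
- by apply: subset_closure; left; rewrite /eball/= (Sx : enorm x = 1).
- refine (@not_interior_ray _ _ x _).
  have [r r0 rP] := open_enorm_nbhs (closed_openC closedP) Px.
  exists r => // t t0 tr [|].
    rewrite /eball/= -[X in X + _]scale1r -scalerDl enormZ (Sx : enorm x = 1) mulr1.
    by rewrite gtr0_norm; lra.
  apply: rP; rewrite addrC addKr enormZ (Sx : enorm x = 1) mulr1 gtr0_norm//.
- by apply: subset_closure; right.
(* A step along the normal leaves [P] at once, and a short one does not reach the ball, as [x] is
   strictly outside it. *)
- refine (@not_interior_ray _ _ (a k) _).
  have a0 := ea ak.
  exists ((enorm x - 1) / enorm (a k)); first by rewrite divr_gt0// subr_gt0.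
  move=> t t0; rewrite ltr_pdivlMr// => tx [|/(_ k)].
    rewrite /eball/= leNgt => /negP; apply.
    have := enormB_ge x (x + t *: a k).
    rewrite opprD addrA subrr sub0r enormN enormZ (gtr0_norm t0) ler_norml.
    by move=> /andP[_]; lra.
  rewrite dotvDr dotvZr bk leNgt => /negP; apply.
  by rewrite ltrDl mulr_gt0// -sqr_enorm exprn_gt0.
Qed.

(** A point strictly inside the ball and on no facet satisfies every constraint with nonzero normal
    strictly. There are finitely many, so a whole neighbourhood stays in the intersection. *)
Lemma bd_inter : bd (@eball R s.+2 `&` P) `<=`
  (S `&` strict_part) `|` ((S `&` \bigcup_k facet k) `|` \bigcup_k inner_facet k).
Proof.
move=> x [+ nint]; have cBP := closedI (@closed_eball R s.+2) closedP.
rewrite -(closure_id _).1// => -[Bx Px].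
have [[k xk]|nF] := pselect (exists k, facet k x).
  have [x1|x1] := ltP (enorm x) 1; first by right; right; exists k.
  right; left; split; last by exists k.
  by apply/eqP; rewrite eq_le x1 andbT.
have strict k : a k = 0 \/ dotv (a k) x < b k.
  have [->|ak] := eqVneq (a k) 0; [by left|right].
  rewrite lt_neqAle (Px k) andbT; apply/eqP => xb.
  by apply: nF; exists k.
have [x1|x1] := ltP (enorm x) 1; last first.
  left; split; first by apply/eqP; rewrite eq_le x1 andbT.
  by split=> // k xk; apply: nF; exists k.
exfalso; apply: nint.
have near_le k : \forall y \near x, dotv (a k) y <= b k.
  have [ak|xk] := strict k; first by near=> y; have := Px k; rewrite ak !dotv0l.
  have : open (dotv (a k) @^-1` [set t | t < b k]).
    by apply: open_comp; [move=> y _; exact: continuous_dotvr|exact: open_lt].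
  by rewrite openE => /(_ x xk); apply: filterS => y /ltW.
have nearB : \forall y \near x, enorm y <= 1.
  have : open ((fun y : V => enorm y) @^-1` [set t | t < 1]).
    by apply: open_comp; [move=> y _; exact: continuous_norm|exact: open_lt].
  by rewrite openE => /(_ x x1); apply: filterS => y /ltW.
have nearP : \forall y \near x, forall k, dotv (a k) y <= b k.
  exact: (@filter_forall V 'I_m (fun k y => dotv (a k) y <= b k) (nbhs x) (nbhs_filter x)).
by apply: filterS (filterI nearB nearP) => y [].
Unshelve. all: by end_near. Qed.

Lemma sphere_cover : S = (S `\` P) `|` (S `&` strict_part) `|` (S `&` \bigcup_k facet k).
Proof.
apply/seteqP; split => x; last by case=> [[]|] [].
move=> Sx; have [Px|] := pselect (P x); last by left; left.
have [[k xk]|nF] := pselect (exists k, facet k x); first by right; split=> //; exists k.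
by left; right; split=> //; split=> // k xk; apply: nF; exists k.
Qed.

(** The gains of [hm_inner_facets] and [hm_outer_facets] add up, and their far parts cover the
    sphere outside [near_set] up to the null set [hm_sphere_facets]. All measures become real
    numbers except that of [F1], which is only bounded below and stays an extended real. *)
Lemma Delta_s_ge :
  ((1 - l)%:E * (hm s S - hm s (S `&` near_set)) <= Delta_s (@eball R s.+2) P)%E.
Proof.
have l0 : 0 < l by rewrite sqrtr_gt0 subr_gt0 expr_lt1// ltW.
have l1 : l <= 1 by rewrite -[leRHS]sqrtr1 ler_wsqrtr// gerBl sqr_ge0.
have finS A : A `<=` S -> hm s A = (fine (hm s A))%:E.
  move=> AS; rewrite fineK// ge0_fin_numE ?hm_ge0//.
  by rewrite (le_lt_trans (hm_mono s AS))// hm_sphere_fin.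
rewrite /Delta_s /vol_surf -/(hm s _) -/(hm s _).
pose A1 := S `\` P; pose A2 := S `&` strict_part.
pose F1 := \bigcup_k outer_facet k; pose F2 := \bigcup_k inner_facet k.
have A1S : A1 `<=` S by move=> x [].
have A2S : A2 `<=` S by move=> x [].
have nS (A : set V) : A `<=` S -> A `&` near_set `<=` S by move=> AS x [/AS].
have dS (A : set V) : A `<=` S -> A `\` near_set `<=` S by move=> AS x [/AS].
have inner := hm_inner_facets; have outer := hm_outer_facets.
rewrite -/A1 -/F2 in inner; rewrite -/A2 -/F1 in outer.
rewrite (finS _ (nS _ A1S)) (finS _ (dS _ A1S)) -EFinM -EFinD in inner.
have finF2 : hm s F2 = (fine (hm s F2))%:E.
  by rewrite fineK// ge0_fin_numE ?hm_ge0// (le_lt_trans inner)// ltry.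
rewrite (finS _ A2S) (finS _ (dS _ A2S)) -EFinM -EFinD in outer.
rewrite finF2 lee_fin in inner.
have hI : (hm s (bd (@eball R s.+2 `&` P)) <= (fine (hm s A2) + fine (hm s F2))%:E)%E.
  apply: le_trans (hm_mono s bd_inter) _; rewrite -/A2 -/F2.
  apply: le_trans (hmU2 _ _ _) _; rewrite EFinD -(finS _ A2S) -finF2.
  rewrite leeD2l//; apply: le_trans (hmU2 _ _ _) _.
  by rewrite hm_sphere_facets add0e.
have hU : ((fine (hm s A1))%:E + hm s F1 <= hm s (bd (@eball R s.+2 `|` P)))%E.
  rewrite -(finS _ A1S); apply: le_trans (hm_mono s bd_union).
  (* [A1] lies on the sphere and [F1] strictly outside, so cutting with the sphere makes their
     measures add. *)
  rewrite (hm_split s (A1 `|` F1) borelS); apply: leeD; apply: hm_mono => x.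
    by move=> Ax; split; [left|case: Ax].
  move=> Fx; split; [by right|]; case: Fx => k _ [_ [x1 _]] /= Sx.
  by rewrite (Sx : enorm x = 1) ltxx in x1.
have hS : (fine (hm s S) - fine (hm s (S `&` near_set)) <=
    fine (hm s (A1 `\` near_set)) + fine (hm s (A2 `\` near_set))).
  rewrite lerBlDl -lee_fin !EFinD -(finS S)// -(finS (S `&` _)); last by move=> x [].
  rewrite -(finS _ (dS _ A1S)) -(finS _ (dS _ A2S)).
  rewrite {1}(hm_split s S borel_near) leeD2l//.
  rewrite -[leRHS]addr0 -[X in (_ <= _ + X)%E]hm_sphere_facets.
  apply: (@le_trans _ _ (hm s ((A1 `\` near_set) `|` (A2 `\` near_set) `|`
      (S `&` \bigcup_k facet k)))).
    apply: hm_mono => x [Sx Nx]; move: (Sx); rewrite {1}sphere_cover.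
    by case=> [[]|]; [left; left|left; right|right].
  apply: le_trans (hmU2 _ _ _) _; rewrite leeD2r//.
  exact: hmU2.
have hA1 : fine (hm s A1) = fine (hm s (A1 `&` near_set)) + fine (hm s (A1 `\` near_set)).
  apply: EFin_inj; rewrite EFinD -(finS _ A1S) -(finS _ (nS _ A1S)) -(finS _ (dS _ A1S)).
  exact: hm_split.
have fI : hm s (bd (@eball R s.+2 `&` P)) \is a fin_num.
  by rewrite ge0_fin_numE ?hm_ge0// (le_lt_trans hI)// ltry.
rewrite leeBrDr//; apply: le_trans hU.
apply: le_trans (leeD2l _ hI) _.
apply: le_trans (leeD2l _ outer).
rewrite (finS S)// (finS (S `&` _)); last by move=> x [].
rewrite -EFinB -EFinM -!EFinD lee_fin.
have := ler_wpM2l (_ : 0 <= 1 - l) hS; rewrite subr_ge0 => /(_ l1); lra.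
Qed.

End Polytope.

(** * Choice of the constants *)

Lemma bd_eball (R : realType) n : bd (@eball R n) `<=` @sphere R n.
Proof.
move=> x [+ nint].
have cB := @closed_eball R n.
rewrite -(closure_id _).1// => Bx.
apply/eqP; rewrite eq_le; apply/andP; split; first exact: Bx.
rewrite leNgt; apply/negP => x1; apply: nint.
have : open ((fun y : 'rV[R]_n => enorm y) @^-1` [set t | t < 1]).
  by apply: open_comp; [move=> y _; exact: continuous_enorm_id|exact: open_lt].
by rewrite openE => /(_ x x1); apply: filterS => y /ltW.
Qed.

Theorem theorem2 (R : realType) :
  exists (c : R) (M0 : nat), 0 < c /\
    forall (n M : nat) (P : set 'rV[R]_n),
      (2 <= n)%N -> (M0 <= M)%N -> polytope_le_facets M P ->
      ((c / (M%:R `^ (2 / (n.-1)%:R)))%:E * vol_surf (bd (@eball R n)) <=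
         Delta_s (@eball R n) P)%E.
Proof.
(* [64] is [32 * 2]: [1 - l] is at least [s0 ^+ 2 / 2 = q ^+ 2 / 32], and at least half of the
   sphere is far from the normals. [M >= 1] gives [q <= 1]. The dimension is now [s.+2], so the
   exponent [n.-1] is [s.+1]. *)
exists (64^-1), 1%N; split=> // -[|[|s]]// M P _ M1.
move=> [m [a [b [mM [-> [Pbounded _]]]]]].
have M_gt0 : 0 < M%:R :> R by rewrite ltr0n.
have M_ge1 : 1 <= M%:R :> R by rewrite ler1n.
pose q : R := M%:R `^ (- (s.+1%:R^-1)).
have q_gt0 : 0 < q by rewrite powR_gt0.
have q_le1 : q <= 1.
  by rewrite -(powRr0 M%:R) ler_powR// oppr_le0 invr_ge0.
have qM : q ^+ s.+1 = M%:R^-1.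
  by rewrite -powR_mulrn ?powR_ge0// -powRrM mulNr mulVf// powR_inv1// ltW.
have q2 : (M%:R `^ (2 / s.+1%:R))^-1 = q ^+ 2.
  rewrite -powRN -powR_mulrn ?powR_ge0// -powRrM; congr (_ `^ _).
  by rewrite mulNr mulrC.
(* With the divisor 4, [l >= 1 / 2] and thus [s0 / l <= q / 2]. As [q ^+ s.+1 = 1 / M], at most [M]
   caps then cover at most the fraction [2 ^- s.+1], hence at most half, of the sphere. *)
pose s0 := q / 4; have s0_gt0 : 0 < s0 by rewrite divr_gt0.
have s0_lt1 : s0 < 1 by rewrite /s0; lra.
apply: (le_trans _ (Delta_s_ge Pbounded s0_gt0 s0_lt1)).
have near_le := hm_near a s0_gt0 s0_lt1.
set l := Num.sqrt (1 - s0 ^+ 2) in near_le *.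
set S := sphere (n := s.+2) in near_le *; set N := near_set a s0 in near_le *.
have finS (A : set 'rV[R]_s.+2) : A `<=` S -> hm s A = (fine (hm s A))%:E.
  move=> AS; rewrite fineK// ge0_fin_numE ?hm_ge0//.
  by rewrite (le_lt_trans (hm_mono s AS))// hm_sphere_fin.
have fS := finS S (@subset_refl _ S); have fN := finS _ (@subIsetl _ S N).
have S_ge0 : 0 <= fine (hm s S) by rewrite fine_ge0// hm_ge0.
rewrite fS fN -EFinM lee_fin in near_le.
rewrite /vol_surf -/(hm s _) (finS _ (@bd_eball R s.+2)) q2 fS fN -EFinB -!EFinM lee_fin.
have bdS : fine (hm s (bd (@eball R s.+2))) <= fine (hm s S).
  rewrite -lee_fin -fS -(finS _ (@bd_eball R s.+2)); apply: hm_mono.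
  exact: bd_eball.
have s02 : s0 ^+ 2 <= 16^-1.
  have -> : s0 ^+ 2 = q ^+ 2 / 16 by rewrite /s0; field.
  by rewrite ler_piMl// exprn_ile1// ltW.
have l_le : l <= 1 - s0 ^+ 2 / 2.
  have h0 : 0 <= 1 - s0 ^+ 2 / 2 by have := sqr_ge0 s0; lra.
  rewrite /l -(ger0_norm h0) -sqrtr_sqr ler_wsqrtr//.
  by have := sqr_ge0 (s0 ^+ 2); nra.
have l_ge : 2^-1 <= l.
  have -> : 2^-1 = Num.sqrt (2^-1 ^+ 2) :> R by rewrite sqrtr_sqr ger0_norm.
  by rewrite ler_wsqrtr//; lra.
have l_gt0 : 0 < l by rewrite (lt_le_trans _ l_ge)// invr_gt0.
have ratio_le : m%:R * (s0 / l) ^+ s.+1 <= 2^-1.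
  have sl_ge0 : 0 <= s0 / l by rewrite ltW// divr_gt0.
  have q2_ge0 : 0 <= q / 2 by rewrite ltW// divr_gt0.
  apply: (@le_trans _ _ (M%:R * (q / 2) ^+ s.+1)).
    apply: ler_pM; rewrite ?ler_nat// ?exprn_ge0//.
    rewrite lerXn2r ?nnegrE// ler_pdivrMr//.
    by rewrite /s0; have := ler_wpM2l (ltW q_gt0) l_ge; lra.
  rewrite expr_div_n qM mulrA mulfV ?gt_eqF// mul1r lef_pV2 ?posrE ?exprn_gt0//.
  by rewrite ler_eXnr// ler1n.
have near_half : fine (hm s (S `&` N)) <= fine (hm s S) / 2.
  by rewrite (le_trans near_le)// mulrC ler_wpM2l.
have q2_ge0 := sqr_ge0 q.
apply: (@le_trans _ _ (64^-1 * q ^+ 2 * fine (hm s S))).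
  by rewrite ler_wpM2l// mulr_ge0.
have l1 : q ^+ 2 / 32 <= 1 - l.
  have -> : q ^+ 2 / 32 = s0 ^+ 2 / 2 by rewrite /s0; field.
  lra.
apply: (@le_trans _ _ (q ^+ 2 / 32 * (fine (hm s S) / 2))).
  by rewrite le_eqVlt; apply/orP; left; apply/eqP; field.
apply: ler_pM => //; first by rewrite divr_ge0.
  by rewrite divr_ge0.
lra.
Qed.
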